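(* Let $A=a_0a_1a_2\cdots$ be a real with a self-modulus $f_A$ that is increasing. Define $B_0=1^{f_A(0)}\,0\,a_0$ and $B_{n+1}=B_n\,1^{f_A(|B_n|)}\,0\,a_{n+1}$, and let $B=\lim_n B_n$. Then $B$ is non-$\mu$-random of level $\omega$ for every continuous probability measure $\mu$ on $2^{\mathbb N}$.
   Context: $1^k$ is a block of $k$ ones; juxtaposition is concatenation. $f$ dominates $g$ if $f(n)>g(n)$ for all but finitely many $n$; $f$ is a modulus for $A$ if every function dominating $f$ computes $A$; $f_A$ is a self-modulus if it is a modulus for $A$ and $f_A\equiv_T A$. $[\sigma]$ is the set of reals extending $\sigma$; $\log$ is binary; $F^{(n)}$ is the $n$-fold iterate. A set is $\mu$-c.e. if c.e. in every representation of $\mu$ (a real coding a fast-converging sequence of indices of measures from a fixed countable dense subset of the space of probability measures on $2^{\mathbb N}$). Continuous: all singletons have measure $0$. Dissipation function: $h(l)=\max\{n:\forall|\sigma|=l,\ \mu[\sigma]<2^{-n+1}\}$. For $n\ge1$, a level-$n$ Solovay test for $\mu$ is a $\mu$-c.e. sequence $T$ of finite strings with $\sum_{\sigma\in T}(h^{(n)}(|\sigma|))^{\log n}2^{-h^{(n)}(|\sigma|)}<\infty$; a real fails $T$ if it lies in $[\sigma]$ for infinitely many $\sigma\in T$; it is non-$\mu$-random of level $n$ if it fails some level-$n$ test, and of level $\omega$ if it is non-$\mu$-random of level $n$ for every $n\ge1$. *)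

(* Defs.v *)
From HB Require Import structures.
From mathcomp Require Import all_boot all_order all_algebra.
From mathcomp Require Import all_classical all_reals all_analysis.

Set Implicit Arguments.
Unset Strict Implicit.
Unset Printing Implicit Defensive.

Import Order.TTheory GRing.Theory Num.Theory.

Local Open Scope classical_set_scope.
Local Open Scope ring_scope.

(* Total functions recursive in an oracle [g] (Kleene-Shoenfield): the closure
   of [g] and the initial functions under composition, primitive recursion and
   minimization of functions that always have a zero. *)
Inductive recursive_in (g : nat -> nat) :
    forall k : nat, (k.-tuple nat -> nat) -> Prop :=
| rec_oracle : recursive_in g (fun v : 1.-tuple nat => g (thead v))
| rec_zero k : recursive_in g (fun _ : k.-tuple nat => 0%N)
| rec_succ : recursive_in g (fun v : 1.-tuple nat => (thead v).+1)
| rec_proj k (i : 'I_k) : recursive_in g (fun v : k.-tuple nat => tnth v i)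
| rec_comp k m (f : m.-tuple nat -> nat) (h : 'I_m -> k.-tuple nat -> nat) :
    recursive_in g f -> (forall i, recursive_in g (h i)) ->
    recursive_in g (fun v : k.-tuple nat => f [tuple h i v | i < m])
| rec_prim k (f : k.-tuple nat -> nat) (h : k.+2.-tuple nat -> nat) :
    recursive_in g f -> recursive_in g h ->
    recursive_in g (fun v : k.+1.-tuple nat =>
      nat_rec (fun _ => nat) (f [tuple of behead v])
        (fun n r => h [tuple of [:: n, r & behead v]]) (thead v))
| rec_min k (f : k.+1.-tuple nat -> nat) (u : k.-tuple nat -> nat) :
    recursive_in g f ->
    (forall v, f [tuple of u v :: v] = 0%N /\
               forall n, (n < u v)%N -> f [tuple of n :: v] <> 0%N) ->
    recursive_in g u.

Definition computes (g f : nat -> nat) : Prop :=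
  recursive_in g (fun v : 1.-tuple nat => f (thead v)).

Definition turing_equiv (f g : nat -> nat) : Prop := computes f g /\ computes g f.

Definition charf (A : nat -> bool) : nat -> nat := fun n => nat_of_bool (A n).

Definition dominates (f g : nat -> nat) : Prop :=
  exists N, forall n, (N <= n)%N -> (g n < f n)%N.

Definition is_modulus (f : nat -> nat) (A : nat -> bool) : Prop :=
  forall g, dominates g f -> computes g (charf A).

Definition is_self_modulus (f : nat -> nat) (A : nat -> bool) : Prop :=
  is_modulus f A /\ turing_equiv f (charf A).

Definition ce_in (g : nat -> nat) (S : set nat) : Prop :=
  S = set0 \/ exists2 f, computes g f & S = range f.

Definition str_code (s : seq bool) : nat := CodeSeq.code (map nat_of_bool s).

(* Borel structure of 2^N; the carrier is convertible to [nat -> bool]. *)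
Definition borel_cantor := g_sigma_algebraType (@open cantor_space).

Definition cyl (s : seq bool) : set borel_cantor :=
  [set x | mkseq (x : nat -> bool) (size s) = s].

(* [binary_point j] lists the binary digits of [j], least significant first:
   each real of the form s 0 0 0 ... is [binary_point j] for exactly one [j]. *)
Definition binary_point (j : nat) : borel_cantor :=
  fun k => odd (j %/ 2 ^ k)%N.

(* The countable dense set of rational convex combinations of the point masses
   at the [binary_point j]: index [i] codes a finite list of natural weights,
   which are then normalized. It gives a probability measure, and is therefore
   an admissible index, when the weights are not all zero. *)
Definition dense_weights (i : nat) : seq nat := CodeSeq.decode i.

Definition dense_index (i : nat) : Prop := (0 < sumn (dense_weights i))%N.

Section Measures.
Variable R : realType.

Definition dense_measure (i : nat) : {measure set borel_cantor -> \bar R} :=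
  msum (fun j => mscale ((nth 0%N (dense_weights i) j)%:R
                         / (sumn (dense_weights i))%:R)%:nng
                  (dirac (binary_point j)))
       (size (dense_weights i)).

Definition level_dist (m1 m2 : set borel_cantor -> \bar R) (n : nat) : R :=
  2^-1 * \sum_(s : n.-tuple bool) `|fine (m1 (cyl s)) - fine (m2 (cyl s))|.

(* This metric is compatible with the weak topology. *)
Definition measure_dist (m1 m2 : set borel_cantor -> \bar R) : \bar R :=
  (\sum_(0 <= n <oo) (2 ^- n * level_dist m1 m2 n)%:E)%E.

(* The real [r] is (the characteristic function of) the coded graph of [d]. *)
Definition codes_seq (r : nat -> bool) (d : nat -> nat) : Prop :=
  forall m, r m <-> exists n, m = CodeSeq.code [:: n; d n].

Definition represents (r : nat -> bool) (mu : probability borel_cantor R) : Prop :=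
  exists d : nat -> nat,
    [/\ codes_seq r d,
        forall n, dense_index (d n) &
        forall n, (measure_dist (dense_measure (d n)) mu <= (2 ^- n)%:E)%E].

Definition measure_ce (mu : probability borel_cantor R) (T : set (seq bool)) : Prop :=
  forall r, represents r mu -> ce_in (charf r) (str_code @` T).

Definition continuous_measure (mu : probability borel_cantor R) : Prop :=
  forall x : borel_cantor, mu [set x] = 0%E.

Definition small_at (mu : probability borel_cantor R) (l n : nat) : Prop :=
  forall s : seq bool, size s = l -> (mu (cyl s) < (2 * 2 ^- n)%:E)%E.

(* The maximum is attained: n = 0 always qualifies, and n <= l is forced because
   some string of length l has measure at least 2^-l. *)
Definition dissipation (mu : probability borel_cantor R) (l : nat) : nat :=
  xget 0%N [set n | small_at mu l n /\ forall m, small_at mu l m -> (m <= n)%N].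

Definition solovay_weight (mu : probability borel_cantor R) (n : nat)
    (s : seq bool) : R :=
  let k := iter n (dissipation mu) (size s) in
  k%:R `^ (ln n%:R / ln 2) * 2 ^- k.

(* [T] is a set, not an enumeration with repetitions: otherwise repeating one
   string of weight 0 (such as the empty string, for n > 1) would give a test
   that too many reals fail. *)
Definition solovay_test (mu : probability borel_cantor R) (n : nat)
    (T : set (seq bool)) : Prop :=
  measure_ce mu T /\ (\esum_(s in T) (solovay_weight mu n s)%:E < +oo)%E.

Definition fails_test (x : borel_cantor) (T : set (seq bool)) : Prop :=
  infinite_set (T `&` [set s | cyl s x]).

Definition nonrandom_level (mu : probability borel_cantor R) (n : nat)
    (x : borel_cantor) : Prop :=
  exists2 T, solovay_test mu n T & fails_test x T.

Definition nonrandom_level_omega (mu : probability borel_cantor R)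
    (x : borel_cantor) : Prop :=
  forall n, (1 <= n)%N -> nonrandom_level mu n x.

End Measures.

Fixpoint block_str (f : nat -> nat) (A : nat -> bool) (n : nat) : seq bool :=
  if n is m.+1 then
    let b := block_str f A m in
    b ++ nseq (f (size b)) true ++ [:: false; A m.+1]
  else nseq (f 0%N) true ++ [:: false; A 0%N].

(* The limit of the [block_str f A n]: since their lengths exceed n, bit n can be
   read off the n-th one; see [block_realP]. *)
Definition block_real (f : nat -> nat) (A : nat -> bool) : borel_cantor :=
  fun n => nth false (block_str f A n) n.

Lemma size_block_str f A n : (n < size (block_str f A n))%N.
Proof.
elim: n => [|n IH] /=; rewrite !size_cat size_nseq /= addn2 ?addnS //.
by rewrite !ltnS (leq_trans (ltnW IH)) // leq_addr.
Qed.

Lemma nth_block_str f A m n i : (m <= n)%N -> (i < size (block_str f A m))%N ->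
  nth false (block_str f A n) i = nth false (block_str f A m) i.
Proof.
move=> mn im; suff [_ ->] : (i < size (block_str f A n))%N /\
    nth false (block_str f A n) i = nth false (block_str f A m) i by [].
elim: n mn => [|n IH]; first by rewrite leqn0 => /eqP <-.
rewrite leq_eqVlt => /orP[/eqP <- //|/IH[iS <-]] /=.
by rewrite nth_cat size_cat iS ltn_addr.
Qed.

Lemma block_realP f A n : cyl (block_str f A n) (block_real f A).
Proof.
apply: (@eq_from_nth _ false); rewrite size_mkseq // => i iS.
rewrite nth_mkseq // /block_real; have [ni|/ltnW i_n] := leqP n i.
  exact: nth_block_str.
by rewrite -(nth_block_str i_n) // size_block_str.
Qed.

(* Main.v *)
Require Import Defs.
From mathcomp Require Import all_boot all_order all_algebra.
From mathcomp Require Import all_classical all_reals all_analysis.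
From mathcomp Require Import zify ring lra.

(** Let [M j] be the largest mass of a cylinder of length [j]; it decreases to
    [0] because [mu] is continuous. Call a length [j] suitable for [K] when [M j]
    is small compared with [2^-K]. Every representation enumerates suitable
    lengths, but different representations may find different ones first, so the
    tests cannot use the first one found. Comparing [M j] and [M (j-1)] with
    thresholds that strictly increase with [j] isolates, by an open condition, one
    or two suitable lengths for each [K]; iterating [n] times gives between [1] and
    [2^n] lengths [j] at which the [n]-fold iterate of the dissipation function is
    at least [K]. Write [J K] for this finite set.

    If [fA |B_k|] bounds an element of [J K] for infinitely many [k], where [K] is
    computed from a code of [B_k], then [B] fails the test formed by the strings
    [sigma 1^j] with [j] in the set [J K] attached to [sigma]. Otherwise any
    representation computes a function that exceeds [fA] at almost all block
    lengths. Since [fA] is monotone and the next block length is controlled by that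
    function, the representation computes a function dominating [fA], hence [A],
    [fA] and [B], and the prefixes of [B] with length in some [J K] form a test
    that [B] fails. *)

Set Implicit Arguments.
Unset Strict Implicit.
Unset Printing Implicit Defensive.

(** * Functions recursive in an oracle *)

Lemma recursive_in_trans g h k (f : k.-tuple nat -> nat) :
  computes h g -> recursive_in g f -> recursive_in h f.
Proof.
move=> hg; elim=> {k f}.
- exact: hg.
- by move=> k; apply: rec_zero.
- exact: rec_succ.
- by move=> k i; apply: rec_proj.
- by move=> k m f u _ IHf _ IHu; apply: rec_comp.
- by move=> k f u _ IHf _ IHu; apply: rec_prim.
- by move=> k f u _ IHf Hu; apply: rec_min Hu.
Qed.

(* Argument tuples as nested pairs: a variable bound by a sum, a quantifier or a
   minimization is the last component of an extended context. *)
Fixpoint ctx (k : nat) : Type := if k is k'.+1 then (ctx k' * nat)%type else unit.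

Fixpoint ctx_of (k : nat) : k.-tuple nat -> ctx k :=
  if k is k'.+1 then fun v => (ctx_of [tuple of behead v], thead v) else fun=> tt.

Fixpoint of_ctx (k : nat) : ctx k -> k.-tuple nat :=
  if k is k'.+1 then fun x => [tuple of x.2 :: of_ctx x.1] else fun=> [tuple].

Lemma of_ctxK k : cancel (@of_ctx k) (@ctx_of k).
Proof.
elim: k => [[]//|k IH] [x n] /=; congr pair.
by rewrite -[RHS]IH; congr ctx_of; apply: val_inj.
Qed.

Lemma ctx_ofK k : cancel (@ctx_of k) (@of_ctx k).
Proof.
elim: k => [v|k IH v] /=; first by apply: val_inj; case: v => -[].
by rewrite IH [RHS]tuple_eta; apply: val_inj.
Qed.

Section Recursive.
Variable g : nat -> nat.

Definition Rec k (F : ctx k -> nat) : Prop := recursive_in g (F \o @ctx_of k).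

Definition Recb k (P : ctx k -> bool) : Prop := Rec (fun x => nat_of_bool (P x)).

Lemma eq_Rec k (F G : ctx k -> nat) : F =1 G -> Rec F -> Rec G.
Proof. by move=> /funext ->. Qed.

Lemma eq_Recb k (F G : ctx k -> bool) : F =1 G -> Recb F -> Recb G.
Proof. by move=> /funext ->. Qed.

Definition RecV k m (F : ctx k -> ctx m) : Prop :=
  forall i, recursive_in g (fun v => tnth (of_ctx (F (ctx_of v))) i).

Lemma RecV_nil k : RecV (fun _ : ctx k => (tt : ctx 0)).
Proof. by case. Qed.

Lemma RecV_cons k m (F : ctx k -> ctx m) (G : ctx k -> nat) :
  RecV F -> Rec G -> RecV (fun x => ((F x, G x) : ctx m.+1)).
Proof.
move=> HF HG i; case: (unliftP ord0 i) => [j ->|->].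
  by move: (HF j); congr recursive_in; apply/funext => v; rewrite /= tnthS.
by move: HG; congr recursive_in; apply/funext => v.
Qed.

Lemma Rec_subst k m (f : ctx m -> nat) (F : ctx k -> ctx m) :
  Rec f -> RecV F -> Rec (fun x => f (F x)).
Proof.
move=> Hf HF; have := rec_comp Hf HF; rewrite /Rec; congr recursive_in.
apply/funext => v /=; congr f; rewrite -[RHS]of_ctxK; congr ctx_of.
by apply: eq_from_tnth => i; rewrite tnth_mktuple.
Qed.

Lemma RecV_weak k m (F : ctx k -> ctx m) :
  RecV F -> RecV (fun x : ctx k.+1 => F x.1).
Proof.
move=> HF i; have H := rec_comp (HF i) (fun j => rec_proj g (lift ord0 j)).
move: H; congr recursive_in; apply/funext => v /=.
suff -> : [tuple tnth v (lift ord0 j) | j < k] = [tuple of behead v] by [].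
apply: eq_from_tnth => j; rewrite tnth_mktuple tnth_behead; congr tnth.
by apply: val_inj; rewrite /= inordK // ltnS.
Qed.

Lemma RecV_id k : RecV (fun x : ctx k => x).
Proof.
move=> i; have := rec_proj g i; congr recursive_in; apply/funext => v.
by rewrite ctx_ofK.
Qed.

Lemma Rec_var0 k : Rec (fun x : ctx k.+1 => x.2).
Proof. exact: (rec_proj g ord0). Qed.

Lemma Rec_weak k (F : ctx k -> nat) : Rec F -> Rec (fun x : ctx k.+1 => F x.1).
Proof. by move=> HF; apply: (Rec_subst HF (RecV_weak (@RecV_id k))). Qed.

Lemma Rec_var1 k : Rec (fun x : ctx k.+2 => x.1.2).
Proof. by apply: (@Rec_weak (k.+1) (fun x => x.2)); apply: Rec_var0. Qed.
Lemma Rec_var2 k : Rec (fun x : ctx k.+3 => x.1.1.2).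
Proof. by apply: (@Rec_weak (k.+2) (fun x => x.1.2)); apply: Rec_var1. Qed.
Lemma Rec_var3 k : Rec (fun x : ctx k.+4 => x.1.1.1.2).
Proof. by apply: (@Rec_weak (k.+3) (fun x => x.1.1.2)); apply: Rec_var2. Qed.
Lemma Rec_var4 k : Rec (fun x : ctx k.+4.+1 => x.1.1.1.1.2).
Proof. by apply: (@Rec_weak (k.+4) (fun x => x.1.1.1.2)); apply: Rec_var3. Qed.
Lemma Rec_var5 k : Rec (fun x : ctx k.+4.+2 => x.1.1.1.1.1.2).
Proof. by apply: (@Rec_weak (k.+4.+1) (fun x => x.1.1.1.1.2)); apply: Rec_var4. Qed.
Lemma Rec_var6 k : Rec (fun x : ctx k.+4.+3 => x.1.1.1.1.1.1.2).
Proof. by apply: (@Rec_weak (k.+4.+2) (fun x => x.1.1.1.1.1.2)); apply: Rec_var5. Qed.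

Definition Rec1 (f : nat -> nat) := Rec (fun x : ctx 1 => f x.2).
Definition Rec2 (f : nat -> nat -> nat) := Rec (fun x : ctx 2 => f x.1.2 x.2).
Definition Rec3 (f : nat -> nat -> nat -> nat) :=
  Rec (fun x : ctx 3 => f x.1.1.2 x.1.2 x.2).

Lemma Rec_app1 k f (F : ctx k -> nat) : Rec1 f -> Rec F -> Rec (fun x => f (F x)).
Proof.
move=> Hf HF; apply: (@Rec_subst _ 1 _ (fun x => (tt, F x)) Hf).
by apply: RecV_cons HF; apply: RecV_nil.
Qed.

Lemma Rec_app2 k f (F G : ctx k -> nat) :
  Rec2 f -> Rec F -> Rec G -> Rec (fun x => f (F x) (G x)).
Proof.
move=> Hf HF HG; apply: (@Rec_subst _ 2 _ (fun x => (tt, F x, G x)) Hf).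
by apply: (RecV_cons (m := 1)) HG; apply: RecV_cons HF; apply: RecV_nil.
Qed.

Lemma Rec_app3 k f (F G H : ctx k -> nat) :
  Rec3 f -> Rec F -> Rec G -> Rec H -> Rec (fun x => f (F x) (G x) (H x)).
Proof.
move=> Hf HF HG HH; apply: (@Rec_subst _ 3 _ (fun x => (tt, F x, G x, H x)) Hf).
apply: (RecV_cons (m := 2)) HH; apply: (RecV_cons (m := 1)) HG.
by apply: RecV_cons HF; apply: RecV_nil.
Qed.

Lemma Rec_bind k (E : ctx k -> nat -> nat) (F : ctx k -> nat) :
  Rec (fun x : ctx k.+1 => E x.1 x.2) -> Rec F -> Rec (fun x => E x (F x)).
Proof.
move=> HE HF; apply: (@Rec_subst _ k.+1 _ (fun x => (x, F x)) HE).
by apply: RecV_cons HF; apply: RecV_id.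
Qed.

Lemma Rec_succ k (F : ctx k -> nat) : Rec F -> Rec (fun x => (F x).+1).
Proof. by apply: Rec_app1; apply: rec_succ. Qed.

Lemma Rec_const k n : Rec (fun _ : ctx k => n).
Proof. by elim: n => [|n]; [apply: rec_zero|apply: Rec_succ]. Qed.

(** [rec_prim] passes the counter first and the accumulator second. Contexts are read from the
    right, so the counter is [x.2] and the accumulator [x.1.2]. *)
Lemma Rec_nat_rec k (a : ctx k -> nat) (step : ctx k -> nat -> nat -> nat)
    (u : ctx k -> nat) :
  Rec a -> Rec (fun x : ctx k.+2 => step x.1.1 x.2 x.1.2) -> Rec u ->
  Rec (fun x => nat_rec (fun=> nat) (a x) (step x) (u x)).
Proof.
move=> Ha Hs; apply: (@Rec_bind _ (fun x => nat_rec (fun=> nat) (a x) (step x))).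
have := rec_prim Ha Hs; congr recursive_in; apply/funext => v /=.
elim: (thead v) => //= n ->; congr step.
by rewrite /=; congr (ctx_of _); apply: val_inj.
Qed.

Lemma Rec_add k (F G : ctx k -> nat) : Rec F -> Rec G -> Rec (fun x => F x + G x).
Proof.
apply: (Rec_app2 (f := addn)).
apply: (@eq_Rec _ (fun x : ctx 2 => nat_rec (fun=> nat) x.2 (fun _ r => r.+1) x.1.2)).
  by case=> [[[] m] n] /=; elim: m => //= m ->.
apply: (Rec_nat_rec (step := fun _ _ r => r.+1)).
- exact: Rec_var0.
- exact/Rec_succ/Rec_var1.
- exact: Rec_var1.
Qed.

Lemma Rec_pred k (F : ctx k -> nat) : Rec F -> Rec (fun x => (F x).-1).
Proof.
apply: (Rec_app1 (f := predn)).
apply: (@eq_Rec _ (fun x : ctx 1 => nat_rec (fun=> nat) 0 (fun n _ => n) x.2)).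
  by case=> [[] m] /=; case: m.
apply: (Rec_nat_rec (step := fun _ n _ => n)).
- exact: Rec_const.
- exact: Rec_var0.
- exact: Rec_var0.
Qed.

Lemma Rec_sub k (F G : ctx k -> nat) : Rec F -> Rec G -> Rec (fun x => F x - G x).
Proof.
apply: (Rec_app2 (f := subn)).
apply: (@eq_Rec _ (fun x : ctx 2 => nat_rec (fun=> nat) x.1.2 (fun _ r => r.-1) x.2)).
  by case=> [[[] m] n] /=; elim: n => /= [|n ->]; [rewrite subn0|rewrite subnS].
apply: (Rec_nat_rec (step := fun _ _ r => r.-1)).
- exact: Rec_var1.
- exact/Rec_pred/Rec_var1.
- exact: Rec_var0.
Qed.

Lemma Rec_sum k (E : ctx k -> nat -> nat) (u : ctx k -> nat) :
  Rec (fun x : ctx k.+1 => E x.1 x.2) -> Rec u ->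
  Rec (fun x => \sum_(i < u x) E x i).
Proof.
move=> HE Hu.
apply: (@eq_Rec _ (fun x => nat_rec (fun=> nat) 0 (fun n r => r + E x n) (u x))).
  by move=> x; elim: (u x) => /= [|n ->]; rewrite ?big_ord0 ?big_ord_recr.
apply: (Rec_nat_rec (step := fun x n r => r + E x n)) => //; first exact: Rec_const.
apply: Rec_add; first exact: Rec_var1.
apply: (@Rec_subst k.+2 k.+1 (fun x => E x.1 x.2) (fun x => (x.1.1, x.2)) HE).
apply: RecV_cons; last exact: Rec_var0.
exact: (RecV_weak (RecV_weak (@RecV_id k))).
Qed.

Lemma Rec_mul k (F G : ctx k -> nat) : Rec F -> Rec G -> Rec (fun x => F x * G x).
Proof.
apply: (Rec_app2 (f := muln)).
apply: (@eq_Rec _ (fun x : ctx 2 => \sum_(i < x.1.2) x.2)).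
  by case=> [[[] m] n] /=; rewrite sum_nat_const card_ord.
apply: (Rec_sum (E := fun (x : ctx 2) _ => x.2)); exact: Rec_var1.
Qed.

Lemma Rec_exp k (F G : ctx k -> nat) : Rec F -> Rec G -> Rec (fun x => F x ^ G x).
Proof.
apply: (Rec_app2 (f := expn)).
apply: (@eq_Rec _ (fun x : ctx 2 => nat_rec (fun=> nat) 1 (fun _ r => x.1.2 * r) x.2)).
  by case=> [[[] m] n] /=; elim: n => //= n ->; rewrite expnS.
apply: (Rec_nat_rec (step := fun (x : ctx 2) _ r => x.1.2 * r)).
- exact: Rec_const.
- by apply: Rec_mul; [exact: Rec_var3|exact: Rec_var1].
- exact: Rec_var0.
Qed.

Lemma Recb_neg k (P : ctx k -> bool) : Recb P -> Recb (fun x => ~~ P x).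
Proof.
move=> HP; apply: (@eq_Rec _ (fun x => 1 - P x)); first by move=> x; case: (P x).
exact/Rec_sub/HP/Rec_const.
Qed.

Lemma Recb_and k (P Q : ctx k -> bool) : Recb P -> Recb Q -> Recb (fun x => P x && Q x).
Proof.
move=> HP HQ; apply: (@eq_Rec _ (fun x => P x * Q x)).
  by move=> x; case: (P x) (Q x) => [] [].
exact: Rec_mul.
Qed.

Lemma Recb_or k (P Q : ctx k -> bool) : Recb P -> Recb Q -> Recb (fun x => P x || Q x).
Proof.
move=> HP HQ; apply: (@eq_Recb _ (fun x => ~~ (~~ P x && ~~ Q x))).
  by move=> x; rewrite negb_and !negbK.
by apply/Recb_neg/Recb_and; apply: Recb_neg.
Qed.

Lemma Recb_pos k (F : ctx k -> nat) : Rec F -> Recb (fun x => 0 < F x).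
Proof.
move=> HF; apply: (@eq_Rec _ (fun x => 1 - (1 - F x))); first by move=> x; case: (F x).
by do 2?apply: Rec_sub => //; apply: Rec_const.
Qed.

Lemma Recb_leq k (F G : ctx k -> nat) : Rec F -> Rec G -> Recb (fun x => F x <= G x).
Proof.
move=> HF HG; apply: (@eq_Recb _ (fun x => ~~ (0 < F x - G x))).
  by move=> x; rewrite -leqNgt leqn0 subn_eq0.
exact/Recb_neg/Recb_pos/Rec_sub.
Qed.

Lemma Recb_eq k (F G : ctx k -> nat) : Rec F -> Rec G -> Recb (fun x => F x == G x).
Proof.
move=> HF HG; apply: (@eq_Recb _ (fun x => (F x <= G x) && (G x <= F x))).
  by move=> x; rewrite -eqn_leq.
by apply: Recb_and; apply: Recb_leq.
Qed.

Lemma Recb_exists k (P : ctx k -> nat -> bool) (u : ctx k -> nat) :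
  Recb (fun x : ctx k.+1 => P x.1 x.2) -> Rec u ->
  Recb (fun x => [exists i : 'I_(u x), P x i]).
Proof.
move=> HP Hu; apply: (@eq_Recb _ (fun x => 0 < \sum_(i < u x) P x i)).
  move=> x; rewrite lt0n sum_nat_eq0 negb_forall; apply: eq_existsb => i.
  by rewrite eqb0 negbK.
by apply: Recb_pos; apply: (Rec_sum (E := fun x i => nat_of_bool (P x i))).
Qed.

Lemma Recb_forall k (P : ctx k -> nat -> bool) (u : ctx k -> nat) :
  Recb (fun x : ctx k.+1 => P x.1 x.2) -> Rec u ->
  Recb (fun x => [forall i : 'I_(u x), P x i]).
Proof.
move=> HP Hu; apply: (@eq_Recb _ (fun x => ~~ [exists i : 'I_(u x), ~~ P x i])).
  by move=> x; rewrite negb_exists; apply: eq_forallb => i; rewrite negbK.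
by apply: Recb_neg; apply: (Recb_exists (P := fun x i => ~~ P x i)) => //; apply: Recb_neg.
Qed.

Lemma Rec_divn k (F G : ctx k -> nat) : Rec F -> Rec G -> Rec (fun x => F x %/ G x).
Proof.
apply: (Rec_app2 (f := divn)).
(* The quotient of [m] by [d > 0] counts the [i < m] with [(i + 1) d <= m]; the guard gives the
   value 0 when [d = 0]. *)
apply: (@eq_Rec _ (fun x : ctx 2 => \sum_(i < x.1.2) ((0 < x.2) && (i.+1 * x.2 <= x.1.2)))).
  case=> [[[] m] [|d]] /=; first by rewrite divn0 big1.
  rewrite (eq_bigr (fun i : 'I_m => nat_of_bool (i < m %/ d.+1))); last first.
    by move=> i _; rewrite leq_divRL.
  by rewrite -big_mkcond -(big_ord_widen m (fun=> 1) (leq_div m d.+1)) sum1_card card_ord.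
apply: (Rec_sum (E := fun (x : ctx 2) i =>
  nat_of_bool ((0 < x.2) && (i.+1 * x.2 <= x.1.2)))); last exact: Rec_var1.
apply: Recb_and; first exact/Recb_pos/Rec_var1.
apply: Recb_leq; last exact: Rec_var2.
by apply: Rec_mul; [exact/Rec_succ/Rec_var0|exact: Rec_var1].
Qed.

Lemma Rec_modn k (F G : ctx k -> nat) : Rec F -> Rec G -> Rec (fun x => F x %% G x).
Proof.
move=> HF HG; apply: (@eq_Rec _ (fun x => F x - F x %/ G x * G x)).
  by move=> x; rewrite {1}(divn_eq (F x) (G x)) addKn.
exact/Rec_sub/Rec_mul/HG/Rec_divn.
Qed.

Lemma Recb_odd k (F : ctx k -> nat) : Rec F -> Recb (fun x => odd (F x)).
Proof.
move=> HF; apply: (@eq_Rec _ (fun x => F x %% 2)) => [x|]; first by rewrite modn2.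
exact/Rec_modn/Rec_const.
Qed.

Lemma Rec_if k (P : ctx k -> bool) (F G : ctx k -> nat) :
  Recb P -> Rec F -> Rec G -> Rec (fun x => if P x then F x else G x).
Proof.
move=> HP HF HG; apply: (@eq_Rec _ (fun x => P x * F x + (1 - P x) * G x)).
  by move=> x; case: (P x); rewrite ?mul1n ?subnn ?subn0 ?mul0n ?add0n ?addn0.
by apply: Rec_add; apply: Rec_mul => //; apply: Rec_sub => //; apply: Rec_const.
Qed.

Lemma Rec_ex_minn k (P : ctx k -> nat -> bool) (exP : forall x, exists n, P x n) :
  Recb (fun x : ctx k.+1 => P x.1 x.2) -> Rec (fun x => ex_minn (exP x)).
Proof.
move=> /Recb_neg HP; apply: (rec_min HP) => v /=.
case: ex_minnP => m; have -> : ctx_of [tuple of behead [tuple of m :: v]] = ctx_of v.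
  by congr ctx_of; apply: val_inj.
rewrite /comp /= => Pm min_m; split; first by rewrite Pm.
move=> n; rewrite ltnNge; have -> : ctx_of [tuple of behead [tuple of n :: v]] = ctx_of v.
  by congr ctx_of; apply: val_inj.
by rewrite theadE; apply: contraNnot; case: (P _ _) (min_m n) => // ->.
Qed.

End Recursive.

Lemma Rec_nat_of_bool g k (P : ctx k -> bool) :
  Recb g P -> Rec g (fun x => nat_of_bool (P x)).
Proof. by []. Qed.

(* [Rec_if] comes last because it unifies with [_ %% _], which unfolds to an [if]. *)
Ltac rec_step := first
  [ assumption
  | apply: Rec_const | apply: Rec_var0 | apply: Rec_var1 | apply: Rec_var2
  | apply: Rec_var3 | apply: Rec_var4 | apply: Rec_var5 | apply: Rec_var6
  | apply: Recb_and | apply: Recb_or | apply: Recb_neg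
  | apply: Recb_leq | apply: Recb_eq | apply: Recb_odd
  | apply: Rec_nat_of_bool | apply: Rec_succ
  | apply: Rec_add | apply: Rec_sub | apply: Rec_mul | apply: Rec_exp
  | apply: Rec_divn | apply: Rec_modn
  | apply: Rec_if ].
Ltac rec := repeat rec_step.

(** * Pairs and codes of lists *)

Definition pair_nat (x t : nat) : nat := 2 ^ x * (2 * t).+1.
(** For positive [n] this is the exponent of 2 in [n], written as a count so that it is a bounded
    sum. *)
Definition fst_nat (n : nat) : nat := \sum_(i < n) (n %% 2 ^ i.+1 == 0).
Definition snd_nat (n : nat) : nat := n %/ 2 ^ (fst_nat n) %/ 2.

Lemma sum_ltn m q : q <= m -> \sum_(i < m) (i < q) = q.
Proof.
by move=> le; rewrite -big_mkcond -(big_ord_widen m (fun=> 1) le) sum1_card card_ord.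
Qed.

Lemma fst_pair_nat x t : fst_nat (pair_nat x t) = x.
Proof.
have e_gt0 : 0 < pair_nat x t by rewrite muln_gt0 expn_gt0.
rewrite -[RHS](@sum_ltn (pair_nat x t)); last first.
  by apply: leq_trans (ltnW (ltn_expl x (ltnSn 1))) _; rewrite leq_pmulr.
apply: eq_bigr => i _; rewrite -/(_ %| _) pfactor_dvdn // lognM ?expn_gt0 //.
by rewrite pfactorK // [logn 2 _.+1]lognE /= dvdn2 /= oddM /= addn0.
Qed.

Lemma snd_pair_nat x t : snd_nat (pair_nat x t) = t.
Proof.
rewrite /snd_nat fst_pair_nat mulKn ?expn_gt0 // -add1n addnC.
by rewrite mulnC divnMDl // addn0.
Qed.

Lemma code_cons x s : CodeSeq.code (x :: s) = pair_nat x (CodeSeq.code s).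
Proof. by rewrite /pair_nat mul2n. Qed.

(** On codes of nonempty lists [fst_nat] is the head and [snd_nat] the tail. The empty list has code
    0, which both maps fix, and 0 is also the default of [nth]. *)
Lemma fst_iter_snd_nat i j : fst_nat (iter j snd_nat i) = nth 0 (CodeSeq.decode i) j.
Proof.
rewrite -{1}(CodeSeq.decodeK i); elim: (CodeSeq.decode i) j => [|n s IH] j.
  rewrite nth_nil; have -> : iter j snd_nat (CodeSeq.code [::]) = 0.
    by elim: j => //= j ->; rewrite /snd_nat !div0n.
  by rewrite /fst_nat big_ord0.
rewrite code_cons; case: j => [|j] /=; first by rewrite fst_pair_nat.
by rewrite -iterS iterSr snd_pair_nat IH.
Qed.

(** This lets sums over the entries of a decoded list run up to its code, a recursive bound; entries
    past the end count as 0. *)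
Lemma size_decode i : size (CodeSeq.decode i) <= i.
Proof.
rewrite -{2}(CodeSeq.decodeK i); elim: (CodeSeq.decode i) => [|n s IH] //=.
have := expn_gt0 2 n; nia.
Qed.

(** * Semidecidable relations *)

Section Semidecidable.
Variable g : nat -> nat.

Lemma Rec_fst_nat k (F : ctx k -> nat) : Rec g F -> Rec g (fun x => fst_nat (F x)).
Proof.
apply: (Rec_app1 (f := fst_nat)).
apply: (Rec_sum (E := fun (x : ctx 1) i => nat_of_bool (x.2 %% 2 ^ i.+1 == 0))); rec.
Qed.

Lemma Rec_snd_nat k (F : ctx k -> nat) : Rec g F -> Rec g (fun x => snd_nat (F x)).
Proof.
apply: (Rec_app1 (f := snd_nat)); rewrite /Rec1 /snd_nat; rec; apply: Rec_fst_nat; rec.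
Qed.

Lemma Rec_pair_nat k (F G : ctx k -> nat) :
  Rec g F -> Rec g G -> Rec g (fun x => pair_nat (F x) (G x)).
Proof. by move=> HF HG; rewrite /pair_nat; rec. Qed.

Lemma Rec_nth_decode k (F G : ctx k -> nat) : Rec g F -> Rec g G ->
  Rec g (fun x => nth 0 (CodeSeq.decode (F x)) (G x)).
Proof.
apply: (Rec_app2 (f := fun i j => nth 0 (CodeSeq.decode i) j)).
apply: (@eq_Rec _ _ (fun x : ctx 2 =>
  fst_nat (nat_rec (fun=> nat) x.1.2 (fun _ r => snd_nat r) x.2))).
  case=> [[[] i] j] /=; rewrite -fst_iter_snd_nat.
  by elim: j => //= j ->.
apply: Rec_fst_nat; apply: (Rec_nat_rec (step := fun _ _ r => snd_nat r)); first by rec.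
  by apply: Rec_snd_nat; rec.
by rec.
Qed.

Lemma Rec_str_code k (b : ctx k -> nat -> bool) (L : ctx k -> nat) :
  Recb g (fun x : ctx k.+1 => b x.1 x.2) -> Rec g L ->
  Rec g (fun x => str_code (mkseq (b x) (L x))).
Proof.
move=> Hb HL.
(* The code is built from the end: after [m] steps the recursion holds the code of the last [m]
   bits. *)
apply: (@eq_Rec _ _ (fun x => nat_rec (fun=> nat) 0
  (fun n r => pair_nat (b x (L x - n.+1)) r) (L x))).
  move=> x; suff H m : m <= L x ->
      nat_rec (fun=> nat) 0 (fun n r => pair_nat (b x (L x - n.+1)) r) m =
      CodeSeq.code (map (fun i => nat_of_bool (b x i)) (iota (L x - m) m)).
    by rewrite H // subnn /str_code /mkseq -map_comp.
  elim: m => //= m IH mL; rewrite IH ?(ltnW mL) // -/(CodeSeq.code _) -code_cons.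
  by rewrite /= subnSK.
apply: (Rec_nat_rec (step := fun x n r => pair_nat (b x (L x - n.+1)) r)) => //.
  exact: Rec_const.
apply: Rec_pair_nat; last exact: Rec_var1.
apply: (@Rec_subst _ _ k.+1 (fun x : ctx k.+1 => nat_of_bool (b x.1 x.2))
  (fun x : ctx k.+2 => (x.1.1, L x.1.1 - x.2.+1))) => //.
apply: RecV_cons; first exact: (RecV_weak (RecV_weak (@RecV_id g k))).
rec; exact: (Rec_weak (Rec_weak HL)).
Qed.

Definition Semi k (P : ctx k -> Prop) : Prop :=
  exists2 Q : ctx k -> nat -> bool, Recb g (fun x : ctx k.+1 => Q x.1 x.2) &
    forall x, P x <-> exists t, Q x t.

Lemma eq_Semi k (P Q : ctx k -> Prop) : (forall x, P x <-> Q x) -> Semi P -> Semi Q.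
Proof. by move=> PQ [S HS SP]; exists S => // x; rewrite -PQ. Qed.

Lemma Semi_dec k (P : ctx k -> bool) : Recb g P -> Semi P.
Proof.
move=> HP; exists (fun x _ => P x); first exact: (Rec_weak HP).
by move=> x; split => [|[]//]; exists 0.
Qed.

Lemma Semi_subst k m (P : ctx m -> Prop) (F : ctx k -> ctx m) :
  Semi P -> RecV g F -> Semi (fun x => P (F x)).
Proof.
move=> [Q HQ QP] HF; exists (fun x t => Q (F x) t) => //.
apply: (@Rec_subst _ k.+1 m.+1 (fun x => nat_of_bool (Q x.1 x.2))
  (fun x => (F x.1, x.2)) HQ).
by apply: RecV_cons; [exact: RecV_weak|exact: Rec_var0].
Qed.

Lemma Semi_ex k (P : ctx k -> nat -> Prop) :
  Semi (fun x : ctx k.+1 => P x.1 x.2) -> Semi (fun x => exists n, P x n).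
Proof.
move=> [Q HQ QP]; exists (fun x t => Q (x, fst_nat t) (snd_nat t)).
  apply: (@Rec_subst _ k.+1 k.+2 (fun x => nat_of_bool (Q x.1 x.2))
    (fun x => ((x.1, fst_nat x.2), snd_nat x.2)) HQ).
  apply: (@RecV_cons _ k.+1 k.+1 (fun x => (x.1, fst_nat x.2))).
    apply: RecV_cons; first exact: (RecV_weak (@RecV_id g k)).
    by apply: Rec_fst_nat; rec.
  by apply: Rec_snd_nat; rec.
move=> x; split=> [[n /(QP (x, n)) [t Qt]]|[t Qt]].
  by exists (pair_nat n t); rewrite fst_pair_nat snd_pair_nat.
by exists (fst_nat t); apply/(QP (x, fst_nat t)); exists (snd_nat t).
Qed.

Lemma Semi_and k (P Q : ctx k -> Prop) : Semi P -> Semi Q -> Semi (fun x => P x /\ Q x).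
Proof.
move=> [P' HP' PP] [Q' HQ' QQ].
apply: (@eq_Semi _ (fun x => exists s, exists t, P' x s && Q' x t)).
  move=> x; rewrite PP QQ; split=> [[s [t /andP[]]]|[[s ?] [t ?]]].
    by split; [exists s|exists t].
  by exists s, t; apply/andP.
apply: Semi_ex; apply: (Semi_ex (P := fun (x : ctx k.+1) t => P' x.1 x.2 && Q' x.1 t)).
apply: Semi_dec; apply: Recb_and; first exact: (Rec_weak HP').
apply: (@Rec_subst _ k.+2 k.+1 (fun x => nat_of_bool (Q' x.1 x.2))
  (fun x => (x.1.1, x.2)) HQ').
apply: RecV_cons; first exact: (RecV_weak (RecV_weak (@RecV_id g k))).
rec.
Qed.

Lemma Semi_or k (P Q : ctx k -> Prop) : Semi P -> Semi Q -> Semi (fun x => P x \/ Q x).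
Proof.
move=> [P' HP' PP] [Q' HQ' QQ]; exists (fun x t => P' x t || Q' x t).
  exact: Recb_or.
move=> x; rewrite PP QQ; split=> [[[t h]|[t h]]|[t /orP[h|h]]].
- by exists t; rewrite h.
- by exists t; rewrite h orbT.
- by left; exists t.
- by right; exists t.
Qed.

(** The search runs over numbers whose two components are a value and a stage confirming it. The
    value found depends on the semidecision procedure and on the oracle, not only on [P]. *)
Lemma Semi_choice k (P : ctx k -> nat -> Prop) :
  Semi (fun x : ctx k.+1 => P x.1 x.2) -> (forall x, exists n, P x n) ->
  exists2 G, Rec g G & forall x, P x (G x).
Proof.
move=> [Q HQ QP] exP.
have ex x : exists t, Q (x, fst_nat t) (snd_nat t).
  have [n /(QP (x, n)) [t Qt]] := exP x.
  by exists (pair_nat n t); rewrite fst_pair_nat snd_pair_nat.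
exists (fun x => fst_nat (ex_minn (ex x))).
  apply: Rec_fst_nat; apply: (Rec_ex_minn (P := fun x t => Q (x, fst_nat t) (snd_nat t))).
  apply: (@Rec_subst _ k.+1 k.+2 (fun x => nat_of_bool (Q x.1 x.2))
    (fun x => ((x.1, fst_nat x.2), snd_nat x.2)) HQ).
  apply: (@RecV_cons _ k.+1 k.+1 (fun x => (x.1, fst_nat x.2))).
    apply: RecV_cons; first exact: (RecV_weak (@RecV_id g k)).
    by apply: Rec_fst_nat; rec.
  by apply: Rec_snd_nat; rec.
by move=> x; case: ex_minnP => t Qt _; apply/(QP (x, fst_nat t)); exists (snd_nat t).
Qed.

Lemma Semi_ce (S : set nat) : Semi (fun x : ctx 1 => S x.2) -> ce_in g S.
Proof.
move=> [Q HQ QP]; have [->|/set0P [s0 Ss0]] := eqVneq S set0; first by left.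
(* Pairs whose stage does not confirm the element are sent to the fixed member [s0]. *)
right; exists (fun t => if Q (tt, fst_nat t) (snd_nat t) then fst_nat t else s0).
  change (Rec1 g (fun t => if Q (tt, fst_nat t) (snd_nat t) then fst_nat t else s0)).
  rewrite /Rec1; apply: Rec_if; last exact: Rec_const; last by apply: Rec_fst_nat; rec.
  apply: (@Rec_subst _ 1 2 (fun x => nat_of_bool (Q x.1 x.2))
    (fun x => ((tt, fst_nat x.2), snd_nat x.2)) HQ).
  apply: (@RecV_cons _ 1 1 (fun x => (tt, fst_nat x.2))).
    by apply: RecV_cons; [exact: RecV_nil|apply: Rec_fst_nat; rec].
  by apply: Rec_snd_nat; rec.
apply/seteqP; split=> [s Ss|_ [t _ <-]].
  have [t Qt] := (QP (tt, s)).1 Ss.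
  by exists (pair_nat s t) => //; rewrite fst_pair_nat snd_pair_nat Qt.
by case: ifP => // Qt; apply: (QP (tt, fst_nat t)).2; exists (snd_nat t).
Qed.

End Semidecidable.

(** * The bits of [block_real] *)

Lemma take_mkseq (T : Type) (h : nat -> T) m n :
  take m (mkseq h n) = mkseq h (minn m n).
Proof. by rewrite /mkseq -map_take take_iota. Qed.

Lemma cyl_take m s x : cyl s x -> cyl (take m s) x.
Proof.
by rewrite /cyl /= => e; rewrite size_take_min -take_mkseq e.
Qed.

Section BlockReal.
Variables (f : nat -> nat) (A : nat -> bool).

Notation bsz k := (size (block_str f A k)).

Lemma size_block_strS k : bsz k.+1 = bsz k + f (bsz k) + 2.
Proof. by rewrite /= !size_cat size_nseq addnA. Qed.

Lemma ltn_size_block_str k m : k < m -> bsz k + 2 <= bsz m.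
Proof.
elim: m => // m IH; rewrite ltnS leq_eqVlt => /orP[/eqP ->|/IH le];
  rewrite size_block_strS; lia.
Qed.

(** Every bit that a block adds is 1 except the last two, [false] and [A k]. So bit [i] is decided
    by whether some [block_str f A k] has length [i + 1] or [i + 2]; the bound on [k] makes this
    recursive in [f] and [A]. *)
Lemma block_realE i : block_real f A i =
  [exists k : 'I_i.+1, (bsz k == i.+1) && A k]
  || ~~ [exists k : 'I_i.+1, (bsz k == i.+1) || (bsz k == i.+2)].
Proof.
have ex : exists k, i < bsz k by exists i; apply: size_block_str.
case: (ex_minnP ex) => k ik min_k.
have k_i : k <= i by apply: min_k; apply: size_block_str.
(* The lengths of different strings are at least 2 apart, so only the first string longer than [i]
   can have length [i + 1] or [i + 2]. *)
have uniq_k k' : (bsz k' == i.+1) || (bsz k' == i.+2) -> k' = k.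
  case: (ltngtP k' k) => // [lt|/ltn_size_block_str]; last lia.
  have : ~~ (i < bsz k') by apply/negP => /min_k; rewrite leqNgt lt.
  lia.
have [p [m [szp def_b]]] : exists p m, size p <= i /\
    block_str f A k = p ++ nseq m true ++ [:: false; A k].
  case: (k) min_k => [|k0] min_k; first by exists [::], (f 0).
  exists (block_str f A k0), (f (bsz k0)); split=> //.
  by rewrite leqNgt; apply/negP => /min_k; rewrite ltnn.
have def_k : bsz k = size p + m + 2 by rewrite def_b !size_cat size_nseq addnA.
rewrite /block_real (nth_block_str k_i ik) def_b.
have -> : [exists k' : 'I_i.+1, (bsz k' == i.+1) && A k'] = (bsz k == i.+1) && A k.
  apply/existsP/idP => [[k' /andP[e Ak']]|h].
    by rewrite -(uniq_k k') ?e.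
  by exists (Ordinal (k_i : k < i.+1)).
have -> : [exists k' : 'I_i.+1, (bsz k' == i.+1) || (bsz k' == i.+2)] =
    (bsz k == i.+1) || (bsz k == i.+2).
  apply/existsP/idP => [[k' e]|h]; first by rewrite -(uniq_k k').
  by exists (Ordinal (k_i : k < i.+1)).
rewrite def_k !nth_cat ltnNge szp /= nth_nseq size_nseq.
have [lt|ge] := ltnP (i - size p) m.
  have -> : (size p + m + 2 == i.+1) = false by lia.
  by have -> : (size p + m + 2 == i.+2) = false by lia.
have [e|ne] : i - size p - m = 0 \/ 0 < i - size p - m by lia.
  have -> : (size p + m + 2 == i.+1) = false by lia.
  have -> : (size p + m + 2 == i.+2) by lia.
  by rewrite e.
have e : i - size p - m = 1 by lia.
have -> : (size p + m + 2 == i.+1) by lia.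
by rewrite e /= orbF.
Qed.

Lemma Recb_block_real g : computes g f -> computes g (charf A) ->
  Recb g (fun x : ctx 1 => block_real f A x.2).
Proof.
move=> Hf HA.
have Hsz k (F : ctx k -> nat) : Rec g F -> Rec g (fun x => bsz (F x)).
  apply: (Rec_app1 (f := fun k => bsz k)).
  apply: (@eq_Rec _ _ (fun x : ctx 1 =>
    nat_rec (fun=> nat) (f 0 + 2) (fun _ r => r + f r + 2) x.2)).
    case=> [[] n] /=; elim: n => [|n /= ->]; first by rewrite /= size_cat size_nseq.
    by rewrite size_cat /= size_cat size_nseq addnA.
  apply: (Rec_nat_rec (step := fun _ _ r => r + f r + 2)); rec.
  by apply: (Rec_app1 (f := f) (Hf : Rec1 g f)); rec.
apply: (@eq_Recb _ _ (fun x : ctx 1 => _) _ (fun x => esym (block_realE x.2))).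
have HA1 k (F : ctx k -> nat) : Rec g F -> Recb g (fun x => A (F x)).
  exact: (Rec_app1 (f := charf A) HA).
apply: Recb_or.
  apply: (Recb_exists (P := fun (x : ctx 1) k => (bsz k == x.2.+1) && A k)); last by rec.
  by apply: Recb_and; [apply: Recb_eq; [apply: Hsz|]; rec|apply: HA1; rec].
apply: Recb_neg.
apply: (Recb_exists (P := fun (x : ctx 1) k =>
  (bsz k == x.2.+1) || (bsz k == x.2.+2))); last by rec.
by apply: Recb_or; apply: Recb_eq; [apply: Hsz|..]; rec; apply: Hsz; rec.
Qed.

Lemma block_real_prefix k j : j <= f (bsz k) ->
  cyl (block_str f A k ++ nseq j true) (block_real f A).
Proof.
move=> jf; have := cyl_take (bsz k + j) (block_realP f A k.+1).
congr (cyl _ _) => /=; rewrite take_cat ltnNge leq_addr /= addKn take_cat size_nseq.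
case: ltnP => [lt|ge]; first by rewrite take_nseq // ltnW.
have -> : j = f (bsz k) by apply/eqP; rewrite eqn_leq jf ge.
by rewrite subnn take0 cats0.
Qed.

End BlockReal.

(** * Comparing dense measures with thresholds *)

Definition dense_mass (i l v : nat) : nat :=
  \sum_(j < i) nth 0 (CodeSeq.decode i) j * (j %% 2 ^ l == v).
Definition dense_total (i : nat) : nat := \sum_(j < i) nth 0 (CodeSeq.decode i) j.

(* Cleared of denominators: the [i]-th dense measure gives each cylinder of length
   [l] less than [x / ((x + 1) 2^K)], with the margin [2^(l+1) / 2^t] by which it
   can differ from a measure at distance at most [2^-t]. *)
Definition below_test (i t K x l : nat) : bool :=
  [forall v : 'I_(2 ^ l), dense_mass i l v * 2 ^ t * (x.+1 * 2 ^ K)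
    + 2 ^ l.+1 * dense_total i * (x.+1 * 2 ^ K) < x * dense_total i * 2 ^ t].
Definition above_test (i t K x l : nat) : bool :=
  [exists v : 'I_(2 ^ l), x * dense_total i * 2 ^ t
    + 2 ^ l.+1 * dense_total i * (x.+1 * 2 ^ K)
    < dense_mass i l v * 2 ^ t * (x.+1 * 2 ^ K)].

Section DenseRec.
Variables (g d : nat -> nat).
Hypothesis Hd : computes g d.

Lemma Rec_dense_mass k (I L V : ctx k -> nat) : Rec g I -> Rec g L -> Rec g V ->
  Rec g (fun x => dense_mass (I x) (L x) (V x)).
Proof.
apply: (Rec_app3 (f := dense_mass)).
apply: (Rec_sum (E := fun (x : ctx 3) j =>
  nth 0 (CodeSeq.decode x.1.1.2) j * (j %% 2 ^ x.1.2 == x.2))); last by rec.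
by apply: Rec_mul; [apply: Rec_nth_decode|]; rec.
Qed.

Lemma Rec_dense_total k (I : ctx k -> nat) : Rec g I ->
  Rec g (fun x => dense_total (I x)).
Proof.
apply: (Rec_app1 (f := dense_total)).
apply: (Rec_sum (E := fun (x : ctx 1) j => nth 0 (CodeSeq.decode x.2) j)); last by rec.
by apply: Rec_nth_decode; rec.
Qed.

Lemma Rec_d k (I : ctx k -> nat) : Rec g I -> Rec g (fun x => d (I x)).
Proof. by apply: (Rec_app1 (f := d)). Qed.

Lemma Semi_below k (K X L : ctx k -> nat) : Rec g K -> Rec g X -> Rec g L ->
  Semi g (fun x => exists t, below_test (d t) t (K x) (X x) (L x)).
Proof.
move=> HK HX HL; apply: (@Semi_subst _ k 3
  (fun x => exists t, below_test (d t) t x.1.1.2 x.1.2 x.2)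
  (fun x => (tt, K x, X x, L x))); last first.
  apply: (RecV_cons (m := 2)) HL; apply: (RecV_cons (m := 1)) HX.
  by apply: RecV_cons HK; apply: RecV_nil.
apply: (Semi_ex (P := fun (x : ctx 3) t => below_test (d t) t x.1.1.2 x.1.2 x.2)).
apply: Semi_dec.
apply: (Recb_forall (P := fun (y : ctx 4) v =>
    dense_mass (d y.2) y.1.2 v * 2 ^ y.2 * (y.1.1.2.+1 * 2 ^ y.1.1.1.2)
    + 2 ^ y.1.2.+1 * dense_total (d y.2) * (y.1.1.2.+1 * 2 ^ y.1.1.1.2)
    < y.1.1.2 * dense_total (d y.2) * 2 ^ y.2)); last by rec.
apply: Recb_leq; [apply: Rec_succ; apply: Rec_add|]; repeat apply: Rec_mul; 
  try (by rec); try apply: Rec_dense_mass; try apply: Rec_dense_total;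
  try apply: Rec_d; rec.
Qed.

Lemma Semi_above k (K X L : ctx k -> nat) : Rec g K -> Rec g X -> Rec g L ->
  Semi g (fun x => exists t, above_test (d t) t (K x) (X x) (L x)).
Proof.
move=> HK HX HL; apply: (@Semi_subst _ k 3
  (fun x => exists t, above_test (d t) t x.1.1.2 x.1.2 x.2)
  (fun x => (tt, K x, X x, L x))); last first.
  apply: (RecV_cons (m := 2)) HL; apply: (RecV_cons (m := 1)) HX.
  by apply: RecV_cons HK; apply: RecV_nil.
apply: (Semi_ex (P := fun (x : ctx 3) t => above_test (d t) t x.1.1.2 x.1.2 x.2)).
apply: Semi_dec.
apply: (Recb_exists (P := fun (y : ctx 4) v =>
    y.1.1.2 * dense_total (d y.2) * 2 ^ y.2
    + 2 ^ y.1.2.+1 * dense_total (d y.2) * (y.1.1.2.+1 * 2 ^ y.1.1.1.2)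
    < dense_mass (d y.2) y.1.2 v * 2 ^ y.2 * (y.1.1.2.+1 * 2 ^ y.1.1.1.2)));
  last by rec.
apply: Recb_leq; [apply: Rec_succ; apply: Rec_add|]; repeat apply: Rec_mul; 
  try (by rec); try apply: Rec_dense_mass; try apply: Rec_dense_total;
  try apply: Rec_d; rec.
Qed.

End DenseRec.

(** Search the graph for a pair with first entry [n]; by injectivity of the code, only [d n] can be
    found as its second entry. *)
Lemma computes_codes_seq r d : codes_seq r d -> computes (charf r) d.
Proof.
move=> rd.
have Hr k (F : ctx k -> nat) : Rec (charf r) F -> Rec (charf r) (fun x => charf r (F x)).
  by apply: Rec_app1; apply: rec_oracle.
have code2 n y : CodeSeq.code [:: n; y] = pair_nat n (pair_nat y 0) by rewrite !code_cons.
have [||G HG GP] := @Semi_choice (charf r) 1 (fun x y => r (pair_nat x.2 (pair_nat y 0))).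
- apply: Semi_dec; apply: (Hr _ (fun x : ctx 2 => pair_nat x.1.2 (pair_nat x.2 0))).
  by apply: Rec_pair_nat; [|apply: Rec_pair_nat]; rec.
- by case=> [[] n]; exists (d n); apply/rd; exists n; rewrite code2.
move: HG; congr recursive_in; apply/funext => v /=.
have /rd [m] := GP (ctx_of v); rewrite -code2 => /(can_inj CodeSeq.codeK) [e1 e2].
by rewrite e2 -e1.
Qed.

(** * Masses of cylinders and the dissipation function *)

Import Order.TTheory GRing.Theory Num.Theory.
Local Open Scope classical_set_scope.
Local Open Scope ring_scope.

Lemma measurable_cyl s : measurable (cyl s).
Proof.
pose F i : set borel_cantor :=
  [set x | (i < size s)%N -> (x : nat -> bool) i = nth false s i].
have -> : cyl s = \bigcap_i F i.
  apply/seteqP; split=> [x xs i _ i_s|x xF].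
    by rewrite -[in RHS](xs : mkseq _ _ = s) nth_mkseq.
  apply: (@eq_from_nth _ false); rewrite size_mkseq // => i i_s.
  by rewrite nth_mkseq // xF.
apply: bigcapT_measurable => i; have [lt|ge] := ltnP i (size s); last first.
  rewrite (_ : F i = setT); first exact: measurableT.
  by apply/seteqP; split=> // x _; rewrite /F /= ltnNge ge.
apply: sub_sigma_algebra.
rewrite (_ : F i = (fun x : cantor_space => x i) @^-1` [set nth false s i]); last first.
  by apply/seteqP; split=> [x /(_ lt)|x /= xi _].
apply: open_comp; last exact: discrete_open.
by move=> x _; exact: (@proj_continuous nat (fun=> bool) i x).
Qed.
#[local] Hint Resolve measurable_cyl : core.

Section CylinderMass.
Variables (R : realType) (mu : probability borel_cantor R).

Definition mass (s : seq bool) : R := fine (mu (cyl s)).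

Lemma massE s : mu (cyl s) = (mass s)%:E.
Proof. by rewrite fineK // fin_num_measure. Qed.

Lemma mass_take k s : mass s <= mass (take k s).
Proof.
rewrite -lee_fin -!massE; apply: le_measure; rewrite ?inE //.
by move=> x; apply: cyl_take.
Qed.

Lemma mass_nil : mass [::] = 1.
Proof.
apply/eqP; rewrite -eqe -massE -(probability_setT mu); apply/eqP; congr (mu _).
by apply/seteqP; split.
Qed.

Lemma mass_rcons s : mass s <= mass (rcons s true) + mass (rcons s false).
Proof.
rewrite -lee_fin EFinD -!massE; apply: le_trans (measureU2 _ _ _) => //.
apply: le_measure; rewrite ?inE //; first exact: measurableU.
move=> x; rewrite /cyl /= !size_rcons /mkseq -(addn1 (size s)) iotaD map_cat /=.
rewrite add0n cats1 => xs.
have xs' : [seq (x : nat -> bool) i | i <- iota 0 (size s)] = s by [].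
by rewrite xs'; case: (x (size s)); [left|right].
Qed.

(** A string of positive mass has a child of positive mass. The string obtained bounds the values
    competing for the maximum in [dissipation]. *)
Lemma exists_mass_gt0 l : exists2 s, size s = l & 0 < mass s.
Proof.
elim: l => [|l [s sl s_gt0]]; first by exists [::]; rewrite // mass_nil.
have := lt_le_trans s_gt0 (mass_rcons s).
have [t_gt0 _|t_le0] := ltP 0 (mass (rcons s true)).
  by exists (rcons s true); rewrite // size_rcons sl.
move=> h; exists (rcons s false); first by rewrite size_rcons sl.
by apply: lt_le_trans h _; rewrite gerDr.
Qed.

(* Koenig's lemma applied to the strings whose mass does not drop below [e]. *)
Lemma mass_vanishes (e : R) : continuous_measure mu -> 0 < e ->
  exists l, forall s, size s = l -> mass s < e.
Proof.
move=> cont_mu e_gt0; apply: contrapT => no_l.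
pose big s := e <= mass s.
pose ext s := forall l, exists t, size t = l /\ big (s ++ t).
have ext0 : ext [::].
  move=> l; apply: contrapT => no_t; apply: no_l; exists l => s sl.
  by rewrite ltNge; apply/negP => es; apply: no_t; exists s.
have extS s : ext s -> exists b, ext (rcons s b).
  move=> ext_s; apply: contrapT => no_b.
  have Hb b : exists l, forall t, size t = l -> ~ big (rcons s b ++ t).
    apply: contrapT => no_lb; apply: no_b; exists b => l; apply: contrapT => no_t.
    by apply: no_lb; exists l => t snd_nat bt; apply: no_t; exists t.
  have [l1 H1] := Hb true; have [l0 H0] := Hb false.
  (* One bit selects a child and the rest is at least as long as both bounds. Truncation keeps
     strings big, which contradicts the bound of that child. *)
  have [[|b t] [//= [snd_nat]]] := ext_s (maxn l1 l0).+1.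
  rewrite -cat_rcons => bt.
  have Hk k : big (rcons s b ++ take k t).
    apply: le_trans bt _; apply: le_trans (mass_take (size s + k.+1) _) _.
    by rewrite take_cat size_rcons ltnNge addnS ltnS leq_addr /= subSS addKn.
  case: b bt Hk => _ Hk.
    by apply: (H1 (take l1 t)) => //; rewrite size_takel // snd_nat leq_maxl.
  by apply: (H0 (take l0 t)) => //; rewrite size_takel // snd_nat leq_maxr.
have [|next nextP] := @choice _ _ (fun s b => ext s -> ext (rcons s b)).
  move=> s; have [/extS[b]|nes] := pselect (ext s); first by exists b.
  by exists true => /nes.
pose p n := iter n (fun s => rcons s (next s)) [::].
have ext_p n : ext (p n) by elim: n => //= n /nextP.
pose x : borel_cantor := fun n => next (p n).
have px n : mkseq (x : nat -> bool) n = p n.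
  elim: n => // n IH.
  by rewrite /mkseq -(addn1 n) iotaD map_cat /= add0n cats1 -/(mkseq _ _) IH addn1.
have def_x : [set x] = \bigcap_n cyl (p n).
  apply/seteqP; split=> [_ -> n _|y yp].
    by rewrite -px /cyl /= size_mkseq.
  apply/funext => n; have := yp n.+1 I; rewrite -px => yn.
  have : mkseq (y : nat -> bool) (size (mkseq (x : nat -> bool) n.+1)) =
      mkseq (x : nat -> bool) n.+1.
    exact: yn.
  by rewrite size_mkseq => /(congr1 (nth false ^~ n)); rewrite !nth_mkseq.
(* By continuity from above the masses along the branch tend to the mass of [x], which is 0,
   although all of them are at least [e]. *)
have : mu (cyl (p n)) @[n --> \oo] --> mu (\bigcap_n cyl (p n)).
  apply: nonincreasing_cvg_mu => //.
  - have fin0 : (mu (cyl (p 0%N)) < +oo)%E by rewrite massE ltry.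
    exact: fin0.
  - by apply: bigcapT_measurable => i; apply: measurable_cyl.
  - apply/nonincreasing_seqP => n; apply/subsetPset => y /(cyl_take n).
    by rewrite -[p n.+1]px -[p n]px take_mkseq (minn_idPl _).
rewrite -def_x cont_mu => cvg0.
have : (e%:E <= 0)%E.
  apply: (cvge_to_ge cvg0); near=> n.
  have [t [/size0nil ->]] := ext_p n 0%N.
  by rewrite cats0 /big -lee_fin -massE.
by rewrite lee_fin leNgt e_gt0.
Unshelve. all: by end_near.
Qed.

Lemma small_atP l n :
  small_at mu l n <-> forall s, size s = l -> mass s < 2 * 2 ^- n.
Proof. by split=> H s /H; rewrite massE lte_fin. Qed.

Lemma small_at_leq l l' n : (l <= l')%N -> small_at mu l n -> small_at mu l' n.
Proof.
move=> ll' /small_atP sm; apply/small_atP => s sl.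
by apply: le_lt_trans (mass_take l s) _; apply: sm; rewrite size_takel // sl.
Qed.

Lemma dissipationP l : small_at mu l (dissipation mu l) /\
  forall m, small_at mu l m -> (m <= dissipation mu l)%N.
Proof.
suff ex : exists n, small_at mu l n /\ forall m, small_at mu l m -> (m <= n)%N.
  exact: (xgetPex 0%N ex).
have [s sl s_gt0] := exists_mass_gt0 l.
have [N _ HN] := near_infty_natSinv_expn_lt (PosNum (divr_gt0 s_gt0 (ltr0n R 2))).
have bnd n : `[< small_at mu l n >] -> (n <= N)%N.
  move=> /asboolP/small_atP/(_ s sl) sm; rewrite leqNgt; apply/negP => /ltnW Nn.
  have := HN n Nn; rewrite /= div1r => h.
  have h2 : 2 / 2 ^+ n < mass s by move: h; clear; lra.
  by have := lt_trans sm h2; rewrite ltxx.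
have ex0 : exists n, `[< small_at mu l n >].
  exists 0%N; apply/asboolP/small_atP => t _; rewrite expr0 invr1 mulr1.
  by apply: le_lt_trans (mass_take 0 t) _; rewrite take0 mass_nil ltr1n.
case: (ex_maxnP ex0 bnd) => m /asboolP sm max_m; exists m; split=> // k ?.
exact/max_m/asboolP.
Qed.

Lemma leq_dissipation l l' : (l <= l')%N -> (dissipation mu l <= dissipation mu l')%N.
Proof.
move=> ll'; apply: (dissipationP l').2; apply: small_at_leq ll' _.
exact: (dissipationP l).1.
Qed.

Lemma leq_iter_dissipation n l l' : (l <= l')%N ->
  (iter n (dissipation mu) l <= iter n (dissipation mu) l')%N.
Proof. by move=> ll'; elim: n => //= n; apply: leq_dissipation. Qed.

End CylinderMass.

(** * Strings as residues, and the error of the dense measures *)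

Definition bits (l v : nat) : seq bool := mkseq (fun k => odd (v %/ 2 ^ k)%N) l.

Lemma modn_double j m : (0 < m)%N -> (j %% (2 * m) = 2 * ((j %/ 2) %% m) + odd j)%N.
Proof.
move=> m_gt0; rewrite {1}(divn_eq j 2) modn2 {1}(divn_eq (j %/ 2) m).
rewrite mulnDl -mulnA (mulnC m 2) -addnA modnMDl [(_ %% m * 2)%N]mulnC modn_small //.
have := ltn_pmod (j %/ 2) m_gt0; case: odd; lia.
Qed.

(** Induction on [l] peels off the lowest digit: [modn_double] splits a residue modulo [2 ^ l.+1]
    into a parity and a residue modulo [2 ^ l]. *)
Lemma eq_bitsP l j v :
  (forall k, (k < l)%N -> odd (j %/ 2 ^ k)%N = odd (v %/ 2 ^ k)%N) <->
  (j = v %[mod 2 ^ l])%N.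
Proof.
elim: l j v => [|l IH] j v; first by rewrite expn0 !modn1.
have pos : (0 < 2 ^ l)%N by rewrite expn_gt0.
have shift k u : (u %/ 2 ^ k.+1 = u %/ 2 %/ 2 ^ k)%N by rewrite -divnMA expnS.
rewrite expnS !modn_double //; split=> [H|e].
  have := H 0%N isT; rewrite expn0 !divn1 => ->; congr (2 * _ + _)%N.
  by apply/IH => k kl; have := H k.+1 kl; rewrite !shift.
have eo : odd j = odd v.
  by move/(congr1 odd): e; rewrite !mul2n ![odd (_.*2 + _)]oddD !odd_double !oddb.
have e2 : (j %/ 2 = v %/ 2 %[mod 2 ^ l])%N.
  by move: e; rewrite eo => /addIn /eqP; rewrite eqn_pmul2l // => /eqP.
case=> [|k] kl; first by rewrite expn0 !divn1.
by rewrite !shift; apply: (IH _ _).2.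
Qed.

Lemma size_bits l v : size (bits l v) = l.
Proof. exact: size_mkseq. Qed.

Lemma cyl_bits l v j : (v < 2 ^ l)%N ->
  (binary_point j \in cyl (bits l v)) = (j %% 2 ^ l == v)%N.
Proof.
move=> v_l; have -> : (j %% 2 ^ l == v)%N = (j %% 2 ^ l == v %% 2 ^ l)%N.
  by rewrite [X in _ = (_ == X)]modn_small.
apply/idP/eqP => [|e]; rewrite inE /cyl /= size_bits.
  move=> e; apply/eq_bitsP => k kl; have := congr1 (nth false ^~ k) e.
  by rewrite !nth_mkseq.
apply: (@eq_from_nth _ false); rewrite !size_mkseq // => k kl.
by rewrite !nth_mkseq //; apply: (eq_bitsP l j v).2.
Qed.

Lemma bits_surj s : exists2 v, (v < 2 ^ size s)%N & s = bits (size s) v.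
Proof.
elim: s => [|b s [v lt e]]; first by exists 0%N.
exists (2 * v + b)%N; first by rewrite /= expnS; case: (b); lia.
rewrite {1}e /bits /= /mkseq /= -[1%N]addn0 iotaDl -map_comp expn0 divn1.
rewrite oddD oddM /= oddb; congr cons; apply: eq_map => k /=.
by rewrite add1n expnS divnMA mulnC divnMDl //; case: (b); rewrite addn0.
Qed.

Lemma sum_nth_decode (c : nat -> nat) i :
  (\sum_(j < size (CodeSeq.decode i)) nth 0 (CodeSeq.decode i) j * c j =
   \sum_(j < i) nth 0 (CodeSeq.decode i) j * c j)%N.
Proof.
rewrite (big_ord_widen _ (fun j => nth 0 (CodeSeq.decode i) j * c j)%N (size_decode i)).
rewrite big_mkcond; apply: eq_bigr => j _.
by case: ltnP => // le; rewrite nth_default.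
Qed.

Lemma dense_totalE i : dense_total i = sumn (dense_weights i).
Proof.
rewrite sumnE (big_nth 0%N) big_mkord /dense_total.
under eq_bigr do rewrite -[nth _ _ _]muln1.
rewrite -(sum_nth_decode (fun=> 1%N)).
by under eq_bigr do rewrite muln1.
Qed.

Section DenseMass.
Variable R : realType.

Lemma dense_massE i l v : (v < 2 ^ l)%N ->
  fine (@dense_measure R i (cyl (bits l v))) = (dense_mass i l v)%:R / (dense_total i)%:R.
Proof.
move=> v_l; rewrite /dense_measure /= /msum.
rewrite (eq_bigr (fun j : 'I_(size (dense_weights i)) =>
   ((nth 0 (CodeSeq.decode i) j * (j %% 2 ^ l == v))%N%:R
     / (dense_total i)%:R)%:E)); last first.
  move=> j _; rewrite /= /mscale /= diracE cyl_bits // -EFinM dense_totalE natrM.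
  by rewrite mulrAC.
rewrite sumEFin /= -mulr_suml -natr_sum.
by rewrite (sum_nth_decode (fun j => (j %% 2 ^ l == v)%N)).
Qed.

(** The factor [x / (x + 1)] makes the thresholds increase strictly with [x] while all stay below
    [2 ^- K]. *)
Definition theta (K x : nat) : R := x%:R / (x.+1%:R * 2 ^+ K).

Lemma theta_gt0 K x : (0 < x)%N -> 0 < theta K x.
Proof. by move=> x0; rewrite divr_gt0 ?mulr_gt0 ?exprn_gt0 ?ltr0n. Qed.

Lemma theta_lt K x y : (x < y)%N -> theta K x < theta K y.
Proof.
move=> xy; rewrite /theta !invfM !mulrA ltr_pM2r ?invr_gt0 ?exprn_gt0 ?ltr0n //.
rewrite ltr_pdivrMr ?ltr0n // mulrAC ltr_pdivlMr ?ltr0n // -!natrM ltr_nat; lia.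
Qed.

Lemma theta_lt_pow K x : theta K x < 2 ^- K.
Proof.
rewrite /theta invfM mulrA gtr_pMl ?invr_gt0 ?exprn_gt0 ?ltr0n //.
by rewrite ltr_pdivrMr ?ltr0n // mul1r ltr_nat.
Qed.

Lemma clear_fractions_below (a b x S T c : R) : 0 < S -> 0 < T -> 0 < c ->
  (a * T * c + b * S * c < x * S * T) = (a / S + b / T < x / c).
Proof.
move=> S0 T0 c0; rewrite addf_div ?gt_eqF // ltr_pdivrMr ?mulr_gt0 //.
rewrite [x / c * _]mulrAC ltr_pdivlMr //; congr (_ < _); ring.
Qed.

Lemma clear_fractions_above (a b x S T c : R) : 0 < S -> 0 < T -> 0 < c ->
  (x * S * T + b * S * c < a * T * c) = (x / c + b / T < a / S).
Proof.
move=> S0 T0 c0; rewrite addf_div ?gt_eqF // ltr_pdivrMr ?mulr_gt0 //.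
rewrite [a / S * _]mulrAC ltr_pdivlMr //; congr (_ < _); ring.
Qed.

Variables (mu : probability borel_cantor R) (d : nat -> nat).
Hypothesis index_d : forall n, dense_index (d n).
Hypothesis dist_d :
  forall n, (measure_dist (dense_measure R (d n)) mu <= (2 ^- n)%:E)%E.

Local Notation approx t l v := ((dense_mass (d t) l v)%:R / (dense_total (d t))%:R : R).
Local Notation err l t := (2 ^+ l.+1 / 2 ^+ t : R).

(** Term [l] of the series defining the metric is already at most [2 ^- t]. Undoing its weight
    [2 ^- l] and the factor 1/2 gives the error. *)
Lemma approx_mass t l v : (v < 2 ^ l)%N ->
  `|approx t l v - mass mu (bits l v)| <= err l t.
Proof.
move=> v_l; rewrite -dense_massE //.
have dist_ge0 n : (0 <= (2 ^- n * level_dist (dense_measure R (d t)) mu n)%:E :> \bar R)%E.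
  rewrite lee_fin mulr_ge0 ?invr_ge0 ?exprn_ge0 //.
  by rewrite /level_dist mulr_ge0 ?invr_ge0 // sumr_ge0.
have := le_trans (@nneseries_lim_ge R _ xpredT 0 l.+1 (fun n _ _ => dist_ge0 n)) (dist_d t).
rewrite big_nat_recr //= => h.
have {}h : 2 ^- l * level_dist (dense_measure R (d t)) mu l <= 2 ^- t.
  by rewrite -lee_fin; apply: le_trans h; rewrite leeDr // sume_ge0.
have sz : size (bits l v) == l by rewrite size_bits.
have {}h : level_dist (dense_measure R (d t)) mu l <= 2 ^+ l / 2 ^+ t.
  by move: h; rewrite ler_pdivrMl ?exprn_gt0.
have h' : 2^-1 * `|fine (dense_measure R (d t) (cyl (bits l v))) - mass mu (bits l v)|
    <= level_dist (dense_measure R (d t)) mu l.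
  rewrite /level_dist ler_pM2l ?invr_gt0 //.
  by rewrite (bigD1 (Tuple sz)) //= lerDl sumr_ge0.
rewrite exprS -mulrA; lra.
Qed.

Lemma err_small l (e : R) : 0 < e -> exists N, forall t, (N <= t)%N -> 2 * err l t < e.
Proof.
move=> e_gt0; have p0 : 0 < e / (2 * 2 ^+ l.+1) by rewrite divr_gt0 ?mulr_gt0 ?exprn_gt0.
have [N _ HN] := near_infty_natSinv_expn_lt (PosNum p0).
exists N => t /HN /=; rewrite div1r ltr_pdivlMr ?mulr_gt0 ?exprn_gt0 //.
by rewrite mulrC mulrA.
Qed.

Lemma dense_total_gt0 t : 0 < (dense_total (d t))%:R :> R.
Proof. by rewrite dense_totalE ltr0n; apply: index_d. Qed.

Definition below K x l := forall s, size s = l -> mass mu s < theta K x.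
Definition above K x l := exists2 s, size s = l & theta K x < mass mu s.

Lemma below_testE t K x l : below_test (d t) t K x l =
  [forall v : 'I_(2 ^ l), approx t l v + err l t < theta K x].
Proof.
apply: eq_forallb => v; rewrite -(ltr_nat R) natrD !natrM !natrX.
by rewrite clear_fractions_below ?dense_total_gt0 ?mulr_gt0 ?exprn_gt0 ?ltr0n.
Qed.

Lemma above_testE t K x l : above_test (d t) t K x l =
  [exists v : 'I_(2 ^ l), theta K x + err l t < approx t l v].
Proof.
apply: eq_existsb => v; rewrite -(ltr_nat R) natrD !natrM !natrX.
by rewrite clear_fractions_above ?dense_total_gt0 ?mulr_gt0 ?exprn_gt0 ?ltr0n.
Qed.

Lemma belowP K x l : below K x l <-> exists t, below_test (d t) t K x l.
Proof.
split=> [H|[t]]; last first.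
  rewrite below_testE => /forallP H s sl.
  have [v] := bits_surj s; rewrite sl => v_l ->.
  have := approx_mass t v_l; rewrite distrC => /ler_normlW h.
  have := H (Ordinal v_l) => /=; lra.
(* The error counts twice: as the margin built into the test and as the distance between the
   approximation and the mass. *)
have ex (v : 'I_(2 ^ l)) : exists N, forall t, (N <= t)%N ->
    2 * err l t < theta K x - mass mu (bits l v).
  by apply: err_small; rewrite subr_gt0; apply: H; rewrite size_bits.
have [N HN] := choice ex.
(* Only finitely many strings have length [l], so one stage serves them all. *)
exists (\max_v N v); rewrite below_testE; apply/forallP => v.
have := HN v _ (leq_bigmax v).
have /ler_normlW := approx_mass (\max_v N v) (ltn_ord v); lra.
Qed.

Lemma aboveP K x l : above K x l <-> exists t, above_test (d t) t K x l.
Proof.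
split=> [[s sl H]|[t]]; last first.
  rewrite above_testE => /existsP[v H]; exists (bits l v); first exact: size_bits.
  have /ler_normlW := approx_mass t (ltn_ord v); lra.
have [v] := bits_surj s; rewrite sl => v_l e.
have gap : 0 < mass mu s - theta K x by rewrite subr_gt0.
have [N HN] := err_small l gap.
exists N; rewrite above_testE; apply/existsP; exists (Ordinal v_l) => /=.
have := approx_mass N v_l; rewrite distrC => /ler_normlW h.
have := HN N (leqnn N); rewrite e; lra.
Qed.

End DenseMass.

(** * Tests *)

Section Weight.
Variable R : realType.

(** Since [k + 1 <= 2 n 2 ^ q], raising to the power [n] leaves [2 ^ (n q)], and [n q <= k / 2]. *)
Lemma leq_expn_half n k : (0 < n)%N ->
  (k.+1 ^ n <= (2 * n) ^ n * 2 ^ (k %/ 2))%N.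
Proof.
move=> n_gt0; set q := (k %/ (2 * n))%N.
have kq : (k.+1 <= 2 * n * 2 ^ q)%N.
  have h1 : (k < q.+1 * (2 * n))%N by apply: ltn_ceil; lia.
  have := ltn_expl q (ltnSn 1); nia.
apply: leq_trans (_ : (2 * n * 2 ^ q) ^ n <= _)%N; first by rewrite leq_exp2r.
rewrite expnMn -expnM leq_mul2l leq_exp2l // leq_divRL // /q.
have := leq_trunc_div k (2 * n); rewrite -mulnA (mulnC n 2); lia.
Qed.

(** The exponent is at most [n], so the power costs a constant times [2 ^ (k / 2)]; the factor
    [2 ^- k] absorbs this and still leaves [2 ^- e]. *)
Lemma weight_bound n : (0 < n)%N -> exists C : R, forall k e, (2 * e <= k)%N ->
  k%:R `^ (ln n%:R / ln 2) * 2 ^- k <= C / 2 ^+ e :> R.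
Proof.
move=> n_gt0; exists ((2 * n) ^ n)%N%:R => k e ek.
have ln2 : 0 < ln 2 :> R by rewrite ln_gt0 // ltr1n.
have a_ge0 : 0 <= ln n%:R / ln 2 :> R.
  by rewrite divr_ge0 ?(ltW ln2) // ln_ge0 // ler1n.
have a_le : ln n%:R / ln 2 <= n%:R :> R.
  rewrite ler_pdivrMr // mulr_natl -lnXn // -natrX.
  by rewrite ler_ln ?posrE ?ltr0n ?expn_gt0 // ler_nat ltnW // ltn_expl.
have pow_le : k%:R `^ (ln n%:R / ln 2) <= ((2 * n) ^ n * 2 ^ (k %/ 2))%N%:R :> R.
  (* With [k + 1] the base is at least 1, as monotonicity in the exponent requires. *)
  apply: le_trans (_ : k.+1%:R `^ n%:R <= _).
    apply: le_trans (_ : k.+1%:R `^ (ln n%:R / ln 2) <= _).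
      by apply: ge0_ler_powR; rewrite ?nnegrE ?ler0n // ler_nat.
    by apply: ler_powR => //; rewrite ler1n.
  by rewrite powR_mulrn ?ler0n // -natrX ler_nat leq_expn_half.
apply: le_trans (ler_wpM2r _ pow_le) _; first by rewrite invr_ge0 exprn_ge0.
rewrite natrM -mulrA ler_wpM2l ?ler0n // ler_pdivrMr ?exprn_gt0 // mulrC.
rewrite ler_pdivlMr ?exprn_gt0 // natrX -exprD ler_eXn2l ?ltr1n //.
have := leq_trunc_div k 2; lia.
Qed.

Lemma geometric_esum_lty (C : R) : 0 <= C ->
  (\esum_(e in [set: nat]) (C / 2 ^+ e)%:E < +oo)%E.
Proof.
move=> C_ge0; have pos e : (0 <= (C / 2 ^+ e)%:E)%E.
  by rewrite lee_fin divr_ge0 ?exprn_ge0.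
rewrite -nneseries_esumT //.
have := @cvg_geometric_eseries_half R (C * 2) 0.
rewrite (_ : (fun k => _) = (fun e => (C / 2 ^+ e)%:E)); last first.
  apply/funext => k; congr EFin; rewrite natrX addn1 exprS invfM mulrA mulrK //.
  by rewrite unitfE.
by move=> /cvg_lim => -> //; rewrite ltry.
Qed.

End Weight.

Lemma infinite_strings (S : set (seq bool)) :
  (forall m, exists2 s, S s & (m <= size s)%N) -> infinite_set S.
Proof.
move=> unb /finite_seqP[t tS]; have [s] := unb (\max_(u <- t) size u).+1.
rewrite tS /= => st; rewrite ltnNge => /negP; apply.
rewrite (big_rem s st) /=; exact: leq_maxl.
Qed.

(** * Chains of light lengths and the tests they give *)

Section Chains.
Variables (R : realType) (mu : probability borel_cantor R).
Hypothesis cont_mu : continuous_measure mu.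

(* The thresholds increase with [j] while the masses of the cylinders of length
   [j] decrease, so the two conditions overlap enough for some [j] to satisfy
   both, but at most two values do. Both conditions being open, this selects a
   length in an effective way that does not depend on a representation. *)
Definition light (K j : nat) : Prop :=
  below mu K (2 * j + 2) j /\ (j = 0%N \/ above mu K (2 * j - 1) j.-1).

(** The [j] with [chain n K j] form the set [J K]. Each length found becomes the exponent of the
    next link, to match the iteration of the dissipation function. *)
Fixpoint chain (n K j : nat) : Prop :=
  if n is m.+1 then exists i, chain m K i /\ light i j else j = K.

Lemma light_two : exists f : nat -> nat, forall K,
  light K (f K) /\ forall j, light K j -> j = f K \/ j = (f K).+1.
Proof.
suff ex K : exists j0, light K j0 /\ forall j, light K j -> j = j0 \/ j = j0.+1.
  by have [f Hf] := choice ex; exists f.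
have exb : exists j, `[< below mu K (2 * j + 2) j >].
  have [l Hl] := mass_vanishes cont_mu (theta_gt0 R K (ltn0Sn 0)).
  exists l; apply/asboolP => s sl; apply: lt_le_trans (Hl s sl) _.
  by apply/ltW/theta_lt; lia.
(* Take the least [j0] meeting the upper condition. If [j0 > 0] failed the lower one, all masses at
   length [j0 - 1] would be at most [theta K (2 j0 - 1)], hence below [theta K (2 j0)], against
   minimality. *)
case: (ex_minnP exb) => j0 /asboolP bj0 min_j0; exists j0; split.
  split=> //; case: j0 bj0 min_j0 => [|i] _ min_j0; first by left.
  right; apply: contrapT => nab.
  suff : (i.+1 <= i)%N by rewrite ltnn.
  apply: min_j0; apply/asboolP => s si; rewrite ltNge; apply/negP => ge.
  apply: nab; exists s => //; apply: lt_le_trans ge; apply: theta_lt; lia.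
move=> j [bj ab]; have : (j0 <= j)%N by apply: min_j0; apply/asboolP.
case: ab => [->|[s sj gt_s]]; first by rewrite leqn0 => /eqP; left.
(* If [j >= j0 + 2], the string witnessing [above] has a prefix of length [j0], of mass below
   [theta K (2 j0 + 2)], which is less than [theta K (2 j - 1)]. *)
move=> j0j; have [lt|] := ltnP j0.+1 j; last by lia.
have lt2 : mass mu s < theta R K (2 * j0 + 2).
  by apply: le_lt_trans (mass_take mu j0 s) _; apply: bj0; rewrite size_takel // sj; lia.
have : theta R K (2 * j - 1) < theta R K (2 * j0 + 2) := lt_trans gt_s lt2.
by rewrite ltNge ltW // theta_lt //; lia.
Qed.

Lemma light_ex K : exists j, light K j.
Proof. by have [f /(_ K)[? _]] := light_two; exists (f K). Qed.

Lemma chain_ex n K : exists j, chain n K j.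
Proof.
elim: n => [|n [i Hi]]; first by exists K.
by have [j Hj] := light_ex i; exists j, i.
Qed.

(** An index [e] packs [N] with [n] binary digits, one per link, each choosing between the two
    lengths that [light_two] allows. *)
Lemma chain_index n (c : nat -> nat) : exists phi : nat -> nat,
  forall N j, chain n (c N) j -> exists2 e, (e %/ 2 ^ n)%N = N & phi e = j.
Proof.
have [f Hf] := light_two.
elim: n => [|n [phi Hphi]].
  by exists c => N j ->; exists N; rewrite ?expn0 ?divn1.
exists (fun e => f (phi (e %/ 2)) + odd e)%N => N j [i [/Hphi[e eN <-] Hj]].
have [->|->] := (Hf (phi e)).2 j Hj; [exists (2 * e)%N|exists (2 * e + 1)%N].
- by rewrite expnS divnMA mulKn.
- by rewrite mulKn // mul2n odd_double addn0.
- by rewrite expnS divnMA mulnC divnMDl // addn0.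
- by rewrite mulnC divnMDl // addn0 muln2 oddD odd_double /= addn1.
Qed.

Lemma light_dissipation K j : light K j -> (K <= dissipation mu j)%N.
Proof.
move=> [bj _]; apply: (dissipationP mu j).2; apply/small_atP => s sj.
apply: lt_trans (bj s sj) (lt_trans (theta_lt_pow R _ _) _).
by rewrite ltr_pMl ?invr_gt0 ?exprn_gt0 // ltr1n.
Qed.

Lemma chain_dissipation n K j : chain n K j -> (K <= iter n (dissipation mu) j)%N.
Proof.
elim: n j => [j -> //|n IH j [i [/IH Ki /light_dissipation ij]]].
by rewrite iterSr; apply: leq_trans Ki _; apply: leq_iter_dissipation.
Qed.

Lemma chain_unbounded n K j m : (iter n (dissipation mu) m < K)%N ->
  chain n K j -> (m < j)%N.
Proof.
move=> mK /chain_dissipation Kj; rewrite ltnNge; apply/negP => jm.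
have := leq_iter_dissipation mu n jm; lia.
Qed.

(** Both mass conditions in [light] are strict inequalities with rational thresholds, so when true
    they are confirmed at a finite stage of any representation. *)
Lemma Semi_chain r n k (K J : ctx k -> nat) : represents r mu ->
  Rec (charf r) K -> Rec (charf r) J ->
  Semi (charf r) (fun x => chain n (K x) (J x)).
Proof.
move=> [d [/computes_codes_seq Hd index_d dist_d]].
have Semi_light m (I L : ctx m -> nat) : Rec (charf r) I -> Rec (charf r) L ->
    Semi (charf r) (fun x => light (I x) (L x)).
  move=> HI HL; apply: Semi_and.
    apply: (eq_Semi (fun x => iff_sym (belowP index_d dist_d _ _ _))).
    by apply: Semi_below => //; rec.
  apply: Semi_or.
    apply: (@eq_Semi _ _ (fun x => L x == 0%N)); first by move=> x; split=> /eqP.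
    by apply: Semi_dec; rec.
  apply: (eq_Semi (fun x => iff_sym (aboveP index_d dist_d _ _ _))).
  by apply: Semi_above => //; [rec|exact: Rec_pred].
elim: n k K J => [|n IH] k K J HK HJ /=.
  apply: (@eq_Semi _ _ (fun x => J x == K x)); first by move=> x; split=> /eqP.
  by apply: Semi_dec; rec.
apply: (Semi_ex (P := fun x i => chain n (K x) i /\ light i (J x))).
apply: Semi_and; first by apply: IH; [exact: Rec_weak|rec].
by apply: Semi_light; [rec|exact: Rec_weak].
Qed.

(** An index [e] with [e %/ 2 ^ n = N] satisfies [2 e <= chain_start n N], as [weight_bound]
    asks. *)
Definition chain_start (n N : nat) : nat := (2 ^ n.+1 * N.+1)%N.

(** A string [F N j] is at least as long as [j], so if [j] has index [e] its weight is at most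
    [C / 2 ^ e]. Charging strings to their indices bounds the sum by a geometric series. The set
    itself mentions no representation. *)
Lemma chain_test n (F : nat -> nat -> seq bool) : (0 < n)%N ->
  (forall N j, (j <= size (F N j))%N) ->
  (forall r, represents r mu ->
     Rec (charf r) (fun x : ctx 2 => str_code (F x.1.2 x.2))) ->
  solovay_test mu n [set s | exists N j, chain n (chain_start n N) j /\ s = F N j].
Proof.
move=> n_gt0 sizeF recF; set T := [set s | _]; split.
  move=> r Hr; apply: Semi_ce.
  apply: (@eq_Semi _ _ (fun x : ctx 1 => exists N, exists j,
      chain n (chain_start n N) j /\ x.2 == str_code (F N j))).
    move=> x; split=> [[N [j [Hc /eqP ->]]]|[s [N [j [Hc ->]]] <-]].
      by exists (F N j) => //; exists N, j.
    by exists N, j; rewrite eqxx.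
  apply: Semi_ex; apply: (Semi_ex (P := fun (x : ctx 2) j =>
      chain n (chain_start n x.2) j /\ x.1.2 == str_code (F x.2 j))).
  apply: Semi_and; first by apply: Semi_chain => //; rewrite /chain_start; rec.
  apply: Semi_dec; apply: Recb_eq; first by rec.
  by apply: (Rec_app2 (f := fun N j => str_code (F N j)) (recF r Hr)); rec.
have [C HC] := weight_bound R n_gt0.
have C_ge0 : 0 <= C.
  have := HC 0%N 0%N isT; rewrite expr0 !divr1; apply: le_trans.
  exact: powR_ge0.
have [phi Hphi] := chain_index n (chain_start n).
have [|psi Hpsi] := @choice _ _ (fun s e => T s ->
    F (e %/ 2 ^ n)%N (phi e) = s /\ solovay_weight mu n s <= C / 2 ^+ e).
  move=> s; have [[N [j [Hc ->]]]|nTs] := pselect (T s); last by exists 0%N.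
  have [e eN ej] := Hphi _ _ Hc; exists e => _; rewrite eN ej; split=> //.
  apply: HC; apply: leq_trans (leq_iter_dissipation mu n (sizeF N j)).
  apply: leq_trans (chain_dissipation Hc); rewrite -eN.
  rewrite /chain_start expnS -mulnA leq_mul2l /=.
  by rewrite mulnC ltnW // ltn_ceil // expn_gt0.
(* The index determines [N] and [j], hence the string. *)
have inj_psi : set_inj T psi.
  move=> s t /set_mem Ts /set_mem Tt e.
  by rewrite -(Hpsi s Ts).1 -(Hpsi t Tt).1 e.
apply: le_lt_trans (geometric_esum_lty C_ge0).
apply: le_trans (_ : (\esum_(s in T) (C / 2 ^+ psi s)%:E <= _)%E).
  by apply: le_esum => s Ts; rewrite lee_fin; apply: (Hpsi s Ts).2.
rewrite -(@esum_image R _ _ T psi (fun e => (C / 2 ^+ e)%:E) inj_psi) esum_mkcond.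
apply: le_esum => e _; case: ifP => // _.
by rewrite lee_fin divr_ge0 ?exprn_ge0.
Qed.

End Chains.

(** * Strings padded with ones, and domination *)

Definition padded (N j : nat) : seq bool := bits (fst_nat N) (snd_nat N) ++ nseq j true.

Lemma paddedE N j :
  padded N j =
  mkseq (fun i => (fst_nat N <= i)%N || odd (snd_nat N %/ 2 ^ i)) (fst_nat N + j).
Proof.
apply: (@eq_from_nth _ false).
  by rewrite size_cat size_bits size_nseq size_mkseq.
move=> i; rewrite size_cat size_bits size_nseq => lt.
rewrite nth_mkseq // nth_cat size_bits.
case: ltnP => [lt'|ge]; first by rewrite nth_mkseq.
by rewrite nth_nseq ifT //; lia.
Qed.

Lemma Rec_padded g : Rec g (fun x : ctx 2 => str_code (padded x.1.2 x.2)).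
Proof.
apply: (@eq_Rec _ _ (fun x : ctx 2 => str_code (mkseq (fun i =>
    (fst_nat x.1.2 <= i)%N || odd (snd_nat x.1.2 %/ 2 ^ i)) (fst_nat x.1.2 + x.2)))).
  by move=> x; rewrite paddedE.
apply: (Rec_str_code (b := fun (x : ctx 2) i =>
  (fst_nat x.1.2 <= i)%N || odd (snd_nat x.1.2 %/ 2 ^ i))).
  apply: Recb_or; first by apply: Recb_leq; [apply: Rec_fst_nat|]; rec.
  by apply: Recb_odd; apply: Rec_divn; [apply: Rec_snd_nat|]; rec.
by apply: Rec_add; [apply: Rec_fst_nat|]; rec.
Qed.

(** The bound depends on the length of [s] alone, so a sum over all smaller [N] takes in a code of
    [B_k] when only [|B_k|] is known. *)
Lemma padded_surj s : exists2 N, (N < 4 ^ (size s).+1)%N &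
  forall j, padded N j = s ++ nseq j true.
Proof.
have [v v_lt e] := bits_surj s; exists (pair_nat (size s) v).
  rewrite /pair_nat (_ : 4 = 2 * 2)%N // expnMn expnS.
  have : (0 < 2 ^ size s)%N by rewrite expn_gt0.
  move: (2 ^ size s)%N v_lt => p; nia.
by move=> j; rewrite /padded fst_pair_nat snd_pair_nat -e.
Qed.

(* A bound [G] on [f] at the lengths of the blocks bounds [f] everywhere: the
   next block length after [x] is at most [x + G y + 2] for some [y < x]. *)
Lemma dominates_from_blocks (f G : nat -> nat) (A : nat -> bool) m :
  (forall x y, (x <= y)%N -> (f x <= f y)%N) ->
  (forall k, (m <= k)%N -> (f (size (block_str f A k)) < G (size (block_str f A k)))%N) ->
  dominates (fun x => \sum_(y < x + \sum_(i < x) G i + 3) G y)%N f.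
Proof.
move=> mono_f fG; exists (size (block_str f A m)).+1 => x mx.
have le_sum (F : nat -> nat) i n : (i < n)%N -> (F i <= \sum_(y < n) F y)%N.
  by move=> i_n; rewrite (bigD1 (Ordinal i_n)) //= leq_addr.
have ex : exists k, (x <= size (block_str f A k))%N.
  by exists x; apply/ltnW/size_block_str.
(* As [x] exceeds the length of string [m], the first string reaching [x] has positive index. *)
case: (ex_minnP ex) => -[|k] xk min_k.
  have := size_block_strS f A; have := min_k 0%N.
  have : (size (block_str f A 0) <= size (block_str f A m))%N.
    by case: (m) => // m'; have := @ltn_size_block_str f A 0 m'.+1 isT; lia.
  by lia.
have kx : (size (block_str f A k) < x)%N.
  by rewrite ltnNge; apply/negP => /min_k; rewrite ltnn.
have mk : (m <= k)%N.
  rewrite leqNgt; apply/negP; rewrite leq_eqVlt => /orP[/eqP e|km].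
    by move: xk; rewrite e leqNgt mx.
  have := ltn_size_block_str f A km; lia.
apply: leq_ltn_trans (mono_f _ _ xk) _; apply: leq_trans (fG _ (leqW mk)) _.
(* The next length is [|B_k| + f |B_k| + 2]. Here [|B_k| < x] and [f |B_k|] is below a term of the
   inner sum, so this length is an index of the outer sum. *)
apply: (le_sum G); rewrite size_block_strS.
have := fG k mk; have := le_sum G _ _ kx; lia.
Qed.

Theorem theorem4p3 (A : nat -> bool) (fA : nat -> nat)
    (self_modulus_fA : is_self_modulus fA A)
    (increasing_fA : forall m n : nat, (m <= n)%N -> (fA m <= fA n)%N)
    (R : realType) (mu : probability borel_cantor R)
    (continuous_mu : continuous_measure mu) :
  nonrandom_level_omega mu (block_real fA A).
Proof.
move=> n n_gt0; have [modA [_ fA_A]] := self_modulus_fA.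
pose b k := block_str fA A k.
have size_padded N j : (j <= size (padded N j))%N.
  by rewrite size_cat size_nseq leq_addl.
have [often|] := pselect (forall m, exists k N j, [/\ (m <= k)%N,
    padded N j = b k ++ nseq j true, chain mu n (chain_start n N) j &
    (j <= fA (size (b k)))%N]).
  exists [set s | exists N j, chain mu n (chain_start n N) j /\ s = padded N j].
    by apply: chain_test => // r _; apply: Rec_padded.
  apply: infinite_strings => m; have [k [N [j [mk e Hc jf]]]] := often m.
  exists (padded N j).
    by split; [exists N, j|rewrite /= e; apply: block_real_prefix].
  rewrite e size_cat; have := size_block_str fA A k; rewrite -/(b k); lia.
move=> not_often.
have [m Hm] : exists m, forall k N j, (m <= k)%N -> padded N j = b k ++ nseq j true ->
    chain mu n (chain_start n N) j -> (fA (size (b k)) < j)%N.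
  apply: contrapT => no_m; apply: not_often => m; apply: contrapT => no_k.
  apply: no_m; exists m => k N j mk e Hc; rewrite ltnNge; apply/negP => jf.
  by apply: no_k; exists k, N, j.
have computes_A r : represents r mu -> computes (charf r) (charf A).
  move=> Hr.
  (* Which length [G] finds depends on [r], but by [Hm] every length attached to a code of [B_k]
     with [m <= k] exceeds [fA |B_k|]. *)
  have [||G HG GP] := @Semi_choice (charf r) 1
    (fun x j => chain mu n (chain_start n x.2) j).
  - by apply: Semi_chain => //; rewrite /chain_start; rec.
  - by move=> x; apply: chain_ex.
  pose H x := (\sum_(N < 4 ^ x.+1) G (tt, N : nat))%N.
  have HGr k (F : ctx k -> nat) : Rec (charf r) F -> Rec (charf r) (fun x => G (tt, F x)).
    move=> HF; apply: (@Rec_subst _ k 1 G (fun x => (tt, F x)) HG).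
    by apply: RecV_cons HF; apply: RecV_nil.
  have HH k (F : ctx k -> nat) : Rec (charf r) F -> Rec (charf r) (fun x => H (F x)).
    apply: (Rec_app1 (f := H)).
    apply: (Rec_sum (E := fun (x : ctx 1) N => G (tt, N))); last by rec.
    by apply: HGr; rec.
  have fH k : (m <= k)%N -> (fA (size (b k)) < H (size (b k)))%N.
    move=> mk; have [N N_lt HN] := padded_surj (b k).
    apply: leq_trans (Hm k N _ mk (HN _) (GP (tt, N))) _.
    by rewrite /H (bigD1 (Ordinal N_lt)) //= leq_addr.
  apply: recursive_in_trans (modA _ (dominates_from_blocks increasing_fA fH)).
  change (Rec1 (charf r) (fun x => \sum_(y < x + \sum_(i < x) H i + 3) H y)%N).
  apply: (Rec_sum (E := fun (x : ctx 1) y => H y)); first by apply: HH; rec.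
  apply: Rec_add; last by rec.
  apply: Rec_add; first by rec.
  by apply: (Rec_sum (E := fun (x : ctx 1) y => H y)); [apply: HH|]; rec.
pose pre (N j : nat) := mkseq (block_real fA A : nat -> bool) j.
exists [set s | exists N j, chain mu n (chain_start n N) j /\ s = pre N j].
  apply: chain_test => // [N j|r Hr]; first by rewrite size_mkseq.
  apply: (Rec_str_code (b := fun _ i => (block_real fA A : nat -> bool) i)); last by rec.
  apply: (Rec_app1 (f := fun i => nat_of_bool ((block_real fA A : nat -> bool) i)));
    last by rec.
  have rA := computes_A r Hr.
  (* [A] computes its self-modulus [fA], so [r] computes both and hence the bits of [B]. *)
  exact: Recb_block_real (recursive_in_trans rA fA_A) rA.
apply: infinite_strings => p.
(* Since [chain_start n N > N], [chain_unbounded] makes the prefix obtained longer than [p]. *)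
pose N := iter n (dissipation mu) p.
have [j Hj] := chain_ex continuous_mu n (chain_start n N).
exists (pre N j); first by split; [exists N, j|rewrite /= /cyl /= size_mkseq].
rewrite size_mkseq ltnW //; apply: chain_unbounded Hj.
by rewrite /chain_start -/N leq_pmull // expn_gt0.
Qed.
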